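(* Let $(G,H,\tau,\alpha)$ be a Lie crossed module and $\mathbb{G}=[H\rtimes_\alpha G\rightrightarrows G]$ the associated Lie $2$-group. Let $(\pi\colon E_G\to X_0,\mu,[X_1\rightrightarrows X_0])$ be a principal $G$-bundle over the Lie groupoid $\mathbb{X}=[X_1\rightrightarrows X_0]$. Put $s^*E_G=X_1\times_{s,X_0,\pi}E_G$ and $(s^*E_G)^{\mathrm{dec}}=s^*E_G\times H$. (1) The manifolds $(s^*E_G)^{\mathrm{dec}}$ and $E_G$ form a Lie groupoid $[(s^*E_G)^{\mathrm{dec}}\rightrightarrows E_G]$ with structure maps: source $\tilde s(\gamma,p,h)=p$; target $\tilde t(\gamma,p,h)=\mu(\gamma,p)\tau(h^{-1})$; composition $(\gamma_2,p_2,h_2)\circ(\gamma_1,p_1,h_1)=(\gamma_2\circ\gamma_1,p_1,h_2h_1)$ (defined when $p_2=\tilde t(\gamma_1,p_1,h_1)$); unit $p\mapsto(1_{\pi(p)},p,e_H)$; inverse $(\gamma,p,h)\mapsto(\gamma^{-1},\mu(\gamma,p)\tau(h^{-1}),h^{-1})$. (2) The Lie groupoid $\mathbb{E}^{\mathrm{dec}}:=[(s^*E_G)^{\mathrm{dec}}\rightrightarrows E_G]$ is a principal $\mathbb{G}$-bundle over $\mathbb{X}$, with action functor $\rho\colon\mathbb{E}^{\mathrm{dec}}\times\mathbb{G}\to\mathbb{E}^{\mathrm{dec}}$ given by $(p,g)\mapsto pg$ on objects and $\bigl((\gamma,p,h),(h',g)\bigr)\mapsto\bigl(\gamma,pg,\alpha_{g^{-1}}(h'^{-1}h)\bigr)$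 on morphisms, and bundle projection functor $\mathbb{E}^{\mathrm{dec}}\to\mathbb{X}$ given by $p\mapsto\pi(p)$ on objects and $(\gamma,p,h)\mapsto\gamma$ on morphisms.
   Context: Manifolds are smooth, Hausdorff and second countable. A Lie groupoid $[X_1\rightrightarrows X_0]$ is a groupoid object in manifolds with source $s$ and target $t$ surjective submersions; $f_2\circ f_1$ is defined when $t(f_1)=s(f_2)$. A Lie $2$-group $\mathbb{G}=[G_1\rightrightarrows G_0]$ is a (strict) group object in Lie groupoids: $G_0,G_1$ are Lie groups and all groupoid structure maps are homomorphisms. A Lie crossed module $(G,H,\tau,\alpha)$ consists of Lie groups $G,H$, a smooth action $\alpha\colon G\times H\to H$ of $G$ on $H$ by automorphisms (write $\alpha_g=\alpha(g,\cdot)$) and a Lie group homomorphism $\tau\colon H\to G$ with $\tau(\alpha(g,h))=g\tau(h)g^{-1}$ and $\alpha(\tau(h),h')=hh'h^{-1}$. The associated Lie $2$-group is $[H\rtimes_\alpha G\rightrightarrows G]$ with $s(h,g)=g$, $t(h,g)=\tau(h)g$, $(h_2,g_2)\circ(h_1,g_1)=(h_2h_1,g_1)$, and group product $(h_2,g_2)(h_1,g_1)=(h_2\alpha(g_2,h_1),g_2g_1)$. A principal $\mathbb{G}$-bundle over a Lie groupoid $\mathbb{X}$ is a morphism of Lie groupoids $\pi\colon\mathbb{E}\to\mathbb{X}$ together with a morphism of Lie groupoids $\rho\colon\mathbb{E}\times\mathbb{G}\to\mathbb{E}$ whose components $\rho_i\colon E_i\times G_i\to E_i$ are right Lie group actions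 ($i=0,1$), such that $\pi_i\colon E_i\to X_i$ is a principal $G_i$-bundle for $i=0,1$. For a Lie group $G$, a principal $G$-bundle over a Lie groupoid $\mathbb{X}$, denoted $(\pi\colon E_G\to X_0,\mu,[X_1\rightrightarrows X_0])$, is a principal $G$-bundle $\pi\colon E_G\to X_0$ with a smooth map $\mu\colon X_1\times_{s,X_0,\pi}E_G\to E_G$ such that $\mu(1_{\pi(p)},p)=p$; $\pi(\mu(\gamma,p))=t(\gamma)$; $\mu(\gamma_2\circ\gamma_1,p)=\mu(\gamma_2,\mu(\gamma_1,p))$; and $\mu(\gamma,p)g=\mu(\gamma,pg)$. *)

(* Defs.v *)
From HB Require Import structures.
From mathcomp Require Import all_boot all_algebra.
From mathcomp Require Import boolp classical_sets functions cardinality reals.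
From mathcomp Require Import topology normedtype derive.

Set Implicit Arguments.
Unset Strict Implicit.
Unset Printing Implicit Defensive.

Import GRing.Theory Num.Theory numFieldNormedType.Exports.
Local Open Scope classical_set_scope.
Local Open Scope ring_scope.

(* C^k on an open set U. In finite dimension, f is C^(k+1) iff it is
   differentiable with all its directional derivatives C^k. *)
Fixpoint Ck (R : realType) (V W : normedModType R) (k : nat) (U : set V)
    (f : V -> W) : Prop :=
  match k with
  | 0 => forall x, U x -> {for x, continuous f}
  | k'.+1 => (forall x, U x -> differentiable f x) /\
             (forall v : V, Ck k' U ('D_v f))
  end.

Definition Cinfty (R : realType) (V W : normedModType R) (U : set V)
  (f : V -> W) : Prop := forall k, Ck k U f.

(* A chart with values in R^(cdim). Both cmap and cinv are total functions; they
   are meaningful only on cdom and on cimg. *)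
Record chart (R : realType) (M : Type) := Chart {
  cdim : nat;
  cdom : set M;
  cmap : M -> 'rV[R]_cdim;
  cinv : 'rV[R]_cdim -> M }.

Arguments cdim {R M} c.
Arguments cdom {R M} c.
Arguments cmap {R M} c _.
Arguments cinv {R M} c _.

Definition cimg (R : realType) (M : Type) (c : chart R M) : set 'rV[R]_(cdim c) :=
  cmap c @` cdom c.

Arguments cimg {R M} c _.

Definition is_chart (R : realType) (M : topologicalType) (c : chart R M) : Prop :=
  [/\ open (cdom c), open (cimg c),
      forall x, cdom c x -> cinv c (cmap c x) = x,
      forall x, cdom c x -> {for x, continuous (cmap c)}
    & forall v, cimg c v -> {for v, continuous (cinv c)}].

(* Only data: the axioms of a manifold are in is_manifold. *)
HB.mixin Record hasAtlas (R : realType) M of Topological M := {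
  atlas : set (chart R M) }.

#[short(type="premanifoldType")]
HB.structure Definition PreManifold (R : realType) :=
  {M of Topological M & hasAtlas R M}.

(* The dimension of a chart is not fixed, so that a manifold may have connected
   components of different dimensions. *)
Definition is_manifold (R : realType) (M : premanifoldType R) : Prop :=
  [/\ hausdorff_space M /\ @second_countable M,
      forall c : chart R M, atlas c -> is_chart c,
      forall x : M, exists2 c : chart R M, atlas c & cdom c x
    & forall c d : chart R M, atlas c -> atlas d ->
        Cinfty (cmap c @` (cdom c `&` cdom d)) (cmap d \o cinv c)].

Definition local_rep (R : realType) (M N : Type) (c : chart R M) (d : chart R N)
  (f : M -> N) : 'rV[R]_(cdim c) -> 'rV[R]_(cdim d) := cmap d \o f \o cinv c.

Arguments local_rep {R M N} c d f _.

(* f is smooth on a neighbourhood of x *)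
Definition smooth_at (R : realType) (M N : premanifoldType R) (f : M -> N) (x : M)
    : Prop :=
  {for x, continuous f} /\
  forall (c : chart R M) (d : chart R N), atlas c -> atlas d ->
    cdom c x -> cdom d (f x) ->
    exists U, [/\ open U, U (cmap c x) & Cinfty U (local_rep c d f)].

Definition smooth (R : realType) (M N : premanifoldType R) (f : M -> N) : Prop :=
  forall x, smooth_at f x.

Definition submersion (R : realType) (M N : premanifoldType R) (f : M -> N)
    : Prop :=
  smooth f /\
  forall x (c : chart R M) (d : chart R N), atlas c -> atlas d ->
    cdom c x -> cdom d (f x) ->
    forall w, exists v, 'd (local_rep c d f) (cmap c x) v = w.

(* A map defined on a subset A of M is smooth at x when it extends to a smooth
   map on a neighbourhood of x in M. *)
Definition smooth_sub_at (R : realType) (M N : premanifoldType R) (A : set M)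
    (f : set_type A -> N) (x : set_type A) : Prop :=
  exists (F : M -> N) (W : set M),
    [/\ open W, W (val x), forall y, W y -> smooth_at F y
      & forall y : set_type A, W (val y) -> F (val y) = f y].

Definition smooth_sub (R : realType) (M N : premanifoldType R) (A : set M)
  (f : set_type A -> N) : Prop := forall x, smooth_sub_at f x.

Definition id_chart (R : realType) (n : nat) : chart R 'rV[R]_n :=
  @Chart R 'rV[R]_n n setT id id.

HB.instance Definition _ (R : realType) (n : nat) :=
  hasAtlas.Build R 'rV[R]_n [set @id_chart R n].

Definition prod_chart (R : realType) (M N : Type) (c : chart R M) (d : chart R N)
    : chart R (M * N) :=
  @Chart R (M * N)%type (cdim c + cdim d) (cdom c `*` cdom d)
    (fun x => row_mx (cmap c x.1) (cmap d x.2))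
    (fun v => (cinv c (lsubmx v), cinv d (rsubmx v))).

HB.instance Definition _ (R : realType) (M N : premanifoldType R) :=
  hasAtlas.Build R (M * N)%type
    [set e | exists (c : chart R M) (d : chart R N),
       [/\ atlas c, atlas d & e = prod_chart c d]].

(* The charts of a subset A of M are the diffeomorphisms from open subsets of A
   (for the subspace topology) onto open subsets of some R^n. With these charts A
   is a manifold exactly when it is an embedded submanifold of M. *)
Definition sub_atlas (R : realType) (M : premanifoldType R) (A : set M)
    : set (chart R (set_type A)) :=
  [set c | [/\ is_chart c,
      forall x, cdom c x -> smooth_sub_at (cmap c) x
    & forall v, cimg c v -> smooth_at ((val : set_type A -> M) \o cinv c) v]].

HB.instance Definition _ (R : realType) (M : premanifoldType R) (A : set M) :=
  hasAtlas.Build R (set_type A) (@sub_atlas R M A).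

Definition fibre (A B C : Type) (f : A -> C) (g : B -> C) : set (A * B) :=
  [set x | f x.1 = g x.2].

Definition fib (A B C : Type) (f : A -> C) (g : B -> C) (a : A) (b : B)
    (e : f a = g b) : set_type (fibre f g) :=
  exist _ (a, b) (mem_set (e : fibre f g (a, b))).

#[short(type="preLieGroupType")]
HB.structure Definition PreLieGroup (R : realType) :=
  {G of PreManifold R G & Group G}.

Definition is_lie_group (R : realType) (G : preLieGroupType R) : Prop :=
  [/\ is_manifold G,
      smooth (fun x : G * G => (x.1 * x.2)%g : G)
    & smooth (fun x : G => (x^-1)%g : G)].

(* gcomp is defined on the pairs (f2, f1) such that src f2 = tgt f1, and is the
   composite of f1 followed by f2. *)
Record groupoid (R : realType) := Groupoid {
  ob : premanifoldType R;
  ar : premanifoldType R;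
  src : ar -> ob;
  tgt : ar -> ob;
  gcomp : set_type (fibre src tgt) -> ar;
  gunit : ob -> ar;
  ginv : ar -> ar }.

Record is_lie_groupoid (R : realType) (X : groupoid R) : Prop := IsLieGroupoid {
  ob_manifold : is_manifold (ob X);
  ar_manifold : is_manifold (ar X);
  src_submersion : submersion (@src R X);
  src_surj : forall x, exists f, @src R X f = x;
  tgt_submersion : submersion (@tgt R X);
  tgt_surj : forall x, exists f, @tgt R X f = x;
  comp_smooth : smooth_sub (@gcomp R X);
  unit_smooth : smooth (@gunit R X);
  ginv_smooth : smooth (@ginv R X);
  src_unit : forall x, @src R X (gunit x) = x;
  tgt_unit : forall x, @tgt R X (gunit x) = x;
  src_comp : forall f2 f1 (e : @src R X f2 = tgt f1), src (gcomp (fib e)) = src f1;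
  tgt_comp : forall f2 f1 (e : @src R X f2 = tgt f1), tgt (gcomp (fib e)) = tgt f2;
  compA : forall f3 f2 f1 (e32 : @src R X f3 = tgt f2) (e21 : src f2 = tgt f1)
    (e3 : src f3 = tgt (gcomp (fib e21))) (e1 : src (gcomp (fib e32)) = tgt f1),
    gcomp (fib e3) = gcomp (fib e1);
  comp_unitr : forall f (e : @src R X f = tgt (gunit (src f))), gcomp (fib e) = f;
  comp_unitl : forall f (e : @src R X (gunit (tgt f)) = tgt f), gcomp (fib e) = f;
  src_ginv : forall f, @src R X (ginv f) = tgt f;
  tgt_ginv : forall f, @tgt R X (ginv f) = src f;
  comp_ginvr : forall f (e : @src R X f = tgt (ginv f)),
    gcomp (fib e) = gunit (tgt f);
  comp_ginvl : forall f (e : @src R X (ginv f) = tgt f),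
    gcomp (fib e) = gunit (src f) }.

Record is_lie_functor (R : realType) (X Y : groupoid R)
    (F0 : ob X -> ob Y) (F1 : ar X -> ar Y) : Prop := IsLieFunctor {
  functor_smooth0 : smooth F0;
  functor_smooth1 : smooth F1;
  functor_src : forall f, src (F1 f) = F0 (src f);
  functor_tgt : forall f, tgt (F1 f) = F0 (tgt f);
  functor_comp : forall f2 f1 (e : src f2 = tgt f1)
    (e' : src (F1 f2) = tgt (F1 f1)), F1 (gcomp (fib e)) = gcomp (fib e');
  functor_unit : forall x, F1 (gunit x) = gunit (F0 x) }.

Section ProductGroupoid.
Variables (R : realType) (X Y : groupoid R).

Definition prod_src (f : ar X * ar Y) : ob X * ob Y := (src f.1, src f.2).
Definition prod_tgt (f : ar X * ar Y) : ob X * ob Y := (tgt f.1, tgt f.2).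

Lemma prod_composable1 (x : set_type (fibre prod_src prod_tgt)) :
  src (val x).1.1 = tgt (val x).2.1.
Proof. by have /set_mem [] := valP x. Qed.

Lemma prod_composable2 (x : set_type (fibre prod_src prod_tgt)) :
  src (val x).1.2 = tgt (val x).2.2.
Proof. by have /set_mem [] := valP x. Qed.

Definition prod_groupoid : groupoid R :=
  @Groupoid R (ob X * ob Y)%type (ar X * ar Y)%type prod_src prod_tgt
    (fun x => (gcomp (fib (prod_composable1 x)), gcomp (fib (prod_composable2 x))))
    (fun x => (gunit x.1, gunit x.2))
    (fun f => (ginv f.1, ginv f.2)).

End ProductGroupoid.

Record two_group (R : realType) := TwoGroup {
  tg_ob : preLieGroupType R;
  tg_ar : preLieGroupType R;
  tg_src : tg_ar -> tg_ob;
  tg_tgt : tg_ar -> tg_ob;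
  tg_comp : set_type (fibre tg_src tg_tgt) -> tg_ar;
  tg_unit : tg_ob -> tg_ar;
  tg_ginv : tg_ar -> tg_ar }.

Definition groupoid_of_two_group (R : realType) (K : two_group R) : groupoid R :=
  @Groupoid R (tg_ob K) (tg_ar K) (@tg_src R K) (@tg_tgt R K) (@tg_comp R K)
    (@tg_unit R K) (@tg_ginv R K).

Coercion groupoid_of_two_group : two_group >-> groupoid.

Definition is_hom (G H : groupType) (f : G -> H) : Prop :=
  forall x y, f (x * y)%g = (f x * f y)%g.

Record is_lie_2group (R : realType) (K : two_group R) : Prop := IsLie2Group {
  tg_lie_groupoid : is_lie_groupoid K;
  tg_ob_lie_group : is_lie_group (tg_ob K);
  tg_ar_lie_group : is_lie_group (tg_ar K);
  tg_src_hom : is_hom (@tg_src R K);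
  tg_tgt_hom : is_hom (@tg_tgt R K);
  tg_comp_hom : forall f2 f1 k2 k1
    (ef : @tg_src R K f2 = tg_tgt f1) (ek : @tg_src R K k2 = tg_tgt k1)
    (e : @tg_src R K (f2 * k2)%g = tg_tgt (f1 * k1)%g),
    tg_comp (fib e) = (tg_comp (fib ef) * tg_comp (fib ek))%g;
  tg_unit_hom : is_hom (@tg_unit R K);
  tg_ginv_hom : is_hom (@tg_ginv R K) }.

Record crossed_module (G H : groupType) := CrossedModule {
  cm_tau : H -> G;
  cm_act : G -> H -> H;
  cm_act1 : forall h, cm_act 1%g h = h;
  cm_actM : forall g1 g2 h, cm_act (g1 * g2)%g h = cm_act g1 (cm_act g2 h);
  cm_act_hom : forall g, is_hom (cm_act g);
  cm_tau_hom : is_hom cm_tau;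
  cm_tau_act : forall g h, cm_tau (cm_act g h) = (g * cm_tau h * g^-1)%g;
  cm_act_tau : forall h h', cm_act (cm_tau h) h' = (h * h' * h^-1)%g }.

Definition is_lie_crossed_module (R : realType) (G H : preLieGroupType R)
    (cm : crossed_module G H) : Prop :=
  [/\ is_lie_group G, is_lie_group H,
      smooth (fun x : G * H => cm_act cm x.1 x.2 : H)
    & smooth (cm_tau cm : H -> G)].

Definition sdprod (R : realType) (G H : preLieGroupType R)
  (cm : crossed_module G H) : Type := (H * G)%type.

Section SemidirectProduct.
Variables (R : realType) (G H : preLieGroupType R) (cm : crossed_module G H).
Local Open Scope group_scope.

Definition sd_mul (x y : sdprod cm) : sdprod cm :=
  (x.1 * cm_act cm x.2 y.1, x.2 * y.2).
Definition sd_one : sdprod cm := (1, 1).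
Definition sd_inv (x : sdprod cm) : sdprod cm :=
  (cm_act cm x.2^-1 x.1^-1, x.2^-1).

Lemma sd_act1r g : cm_act cm g 1 = 1.
Proof. by apply: (mulgI (cm_act cm g 1)); rewrite -cm_act_hom !mulg1. Qed.

Lemma sd_mulA : associative sd_mul.
Proof.
by move=> [h3 g3] [h2 g2] [h1 g1]; rewrite /sd_mul/= cm_act_hom cm_actM !mulgA.
Qed.

Lemma sd_mul1 : left_id sd_one sd_mul.
Proof. by move=> [h g]; rewrite /sd_mul/= cm_act1 !mul1g. Qed.

Lemma sd_mulr1 : right_id sd_one sd_mul.
Proof. by move=> [h g]; rewrite /sd_mul/= sd_act1r !mulg1. Qed.

Lemma sd_mulV : left_inverse sd_one sd_inv sd_mul.
Proof.
by move=> [h g]; rewrite /sd_mul/= -cm_act_hom !mulVg sd_act1r.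
Qed.

Lemma sd_mulrV : right_inverse sd_one sd_inv sd_mul.
Proof.
by move=> [h g]; rewrite /sd_mul/= -cm_actM mulgV cm_act1 mulgV.
Qed.

HB.instance Definition _ := PreManifold.copy (sdprod cm) (H * G)%type.
HB.instance Definition _ :=
  isGroup.Build (sdprod cm) sd_mulA sd_mul1 sd_mulr1 sd_mulV sd_mulrV.

Definition cm_src (x : sdprod cm) : G := x.2.
Definition cm_tgt (x : sdprod cm) : G := cm_tau cm x.1 * x.2.

Definition cm_two_group : two_group R :=
  @TwoGroup R G (sdprod cm) cm_src cm_tgt
    (fun x => ((val x).1.1 * (val x).2.1, (val x).2.2))
    (fun g => (1, g))
    (fun x => (x.1^-1, cm_tau cm x.1 * x.2)).

End SemidirectProduct.

(* Over U the bundle is trivialised by the G-equivariant diffeomorphism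
   p |-> (pi p, psi p) from pi^-1(U) onto U * G, whose inverse is chi. *)
Record is_principal_bundle (R : realType) (G : preLieGroupType R)
    (E X : premanifoldType R) (pi : E -> X) (act : E * G -> E) : Prop :=
  IsPrincipalBundle {
  pb_lie_group : is_lie_group G;
  pb_total : is_manifold E;
  pb_base : is_manifold X;
  pb_pi_smooth : smooth pi;
  pb_act_smooth : smooth act;
  pb_act1 : forall p, act (p, 1%g) = p;
  pb_actM : forall p g g', act (p, (g * g')%g) = act (act (p, g), g');
  pb_pi_act : forall p g, pi (act (p, g)) = pi p;
  pb_locally_trivial : forall x, exists (U : set X) (psi : E -> G) (chi : X * G -> E),
    [/\ open U /\ U x,
        (forall p, U (pi p) -> smooth_at psi p) /\
        (forall y g, U y -> smooth_at chi (y, g)),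
        forall p, U (pi p) -> chi (pi p, psi p) = p,
        forall y g, U y -> pi (chi (y, g)) = y /\ psi (chi (y, g)) = g
      & forall p g, U (pi p) -> psi (act (p, g)) = (psi p * g)%g] }.

Record is_principal_groupoid_bundle (R : realType) (G : preLieGroupType R)
    (X : groupoid R) (E : premanifoldType R) (pi : E -> ob X) (act : E * G -> E)
    (mu : set_type (fibre (@src R X) pi) -> E) : Prop := IsPrincipalGroupoidBundle {
  pgb_groupoid : is_lie_groupoid X;
  pgb_bundle : is_principal_bundle pi act;
  pgb_mu_smooth : smooth_sub mu;
  pgb_mu_unit : forall p (e : src (gunit (pi p)) = pi p), mu (fib e) = p;
  pgb_pi_mu : forall f p (e : src f = pi p), pi (mu (fib e)) = tgt f;
  pgb_mu_comp : forall f2 f1 p (e21 : src f2 = tgt f1) (e1 : src f1 = pi p)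
    (e : src (gcomp (fib e21)) = pi p) (e2 : src f2 = pi (mu (fib e1))),
    mu (fib e) = mu (fib e2);
  pgb_mu_act : forall f p g (e : src f = pi p) (e' : src f = pi (act (p, g))),
    act (mu (fib e), g) = mu (fib e') }.

Record is_principal_2bundle (R : realType) (K : two_group R) (X E : groupoid R)
    (pi0 : ob E -> ob X) (pi1 : ar E -> ar X)
    (rho0 : ob E * tg_ob K -> ob E) (rho1 : ar E * tg_ar K -> ar E) : Prop :=
  IsPrincipal2Bundle {
  p2b_two_group : is_lie_2group K;
  p2b_base : is_lie_groupoid X;
  p2b_total : is_lie_groupoid E;
  p2b_pi : is_lie_functor pi0 pi1;
  p2b_rho : @is_lie_functor R (prod_groupoid E K) E rho0 rho1;
  p2b_bundle0 : is_principal_bundle pi0 rho0;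
  p2b_bundle1 : is_principal_bundle pi1 rho1 }.

Section Decorated.
Variables (R : realType) (G H : preLieGroupType R) (cm : crossed_module G H).
Variables (X : groupoid R) (E : premanifoldType R) (pi : E -> ob X).
Variables (act : E * G -> E) (mu : set_type (fibre (@src R X) pi) -> E).
Hypothesis hE : is_principal_groupoid_bundle act mu.
Local Open Scope group_scope.

(* (gamma, p, h) is encoded as ((gamma, p), h) with src gamma = pi p. *)
Definition dec : premanifoldType R := (set_type (fibre (@src R X) pi) * H)%type.

Definition dec_arrow (x : dec) : ar X := (val x.1).1.
Definition dec_point (x : dec) : E := (val x.1).2.

Definition dec_src (x : dec) : E := dec_point x.
Definition dec_tgt (x : dec) : E := act (mu x.1, cm_tau cm x.2^-1).

Lemma dec_arrowP (x : dec) : src (dec_arrow x) = pi (dec_point x).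
Proof. by have /set_mem := valP x.1. Qed.

Lemma fib_arrow_point (x : dec) : fib (dec_arrowP x) = x.1.
Proof. by apply: val_inj => /=; case: x => -[[]]. Qed.

Lemma pi_dec_tgt (x : dec) : pi (dec_tgt x) = tgt (dec_arrow x).
Proof.
by rewrite /dec_tgt (pb_pi_act (pgb_bundle hE)) -fib_arrow_point (pgb_pi_mu hE).
Qed.

Lemma dec_composable (x : set_type (fibre dec_src dec_tgt)) :
  src (dec_arrow (val x).1) = tgt (dec_arrow (val x).2).
Proof.
by rewrite dec_arrowP -pi_dec_tgt; congr pi; have /set_mem := valP x.
Qed.

Lemma dec_compP (x : set_type (fibre dec_src dec_tgt)) :
  src (gcomp (fib (dec_composable x))) = pi (dec_point (val x).2).
Proof. by rewrite (src_comp (pgb_groupoid hE)) dec_arrowP. Qed.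

Lemma dec_unitP (p : E) : src (gunit (pi p)) = pi p.
Proof. exact: (src_unit (pgb_groupoid hE)). Qed.

Lemma dec_invP (x : dec) : src (ginv (dec_arrow x)) = pi (dec_tgt x).
Proof. by rewrite (src_ginv (pgb_groupoid hE)) pi_dec_tgt. Qed.

Definition dec_comp (x : set_type (fibre dec_src dec_tgt)) : dec :=
  (fib (dec_compP x), (val x).1.2 * (val x).2.2).
Definition dec_unit (p : E) : dec := (fib (dec_unitP p), 1).
Definition dec_inv (x : dec) : dec := (fib (dec_invP x), x.2^-1).

Definition dec_groupoid : groupoid R :=
  @Groupoid R E dec dec_src dec_tgt dec_comp dec_unit dec_inv.

Lemma dec_rhoP (x : dec) (g : G) :
  src (dec_arrow x) = pi (act (dec_point x, g)).
Proof. by rewrite (pb_pi_act (pgb_bundle hE)) dec_arrowP. Qed.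

Definition dec_rho (y : dec * sdprod cm) : dec :=
  (fib (dec_rhoP y.1 y.2.2), cm_act cm y.2.2^-1 (y.2.1^-1 * y.1.2)).

End Decorated.

(* Main.v *)
From HB Require Import structures.
Require Import Defs.
From mathcomp Require Import all_boot all_algebra.
From mathcomp Require Import boolp classical_sets functions cardinality reals.
From mathcomp Require Import topology normedtype landau derive.

Set Implicit Arguments.
Unset Strict Implicit.
Unset Printing Implicit Defensive.

Import GRing.Theory Num.Theory numFieldNormedType.Exports.
Local Open Scope classical_set_scope.
Local Open Scope ring_scope.

(** The identities between the structure maps of the decorated groupoid follow
   from the action identities of [mu] and from the equivariance and Peiffer
   identities of the crossed module; in particular [pi] is invariant under the
   action, so the factor [tau (h^-1)] in the target changes neither
   composability in [X] nor the projection to [X]. What takes work is that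
   everything is smooth.

   Smoothness is reduced to a calculus of maps between manifolds: composites,
   pairs and projections of smooth maps are smooth, by the chain rule for C^k
   maps ([Ck_comp]), and a map into an embedded submanifold is smooth as soon as
   it is so into the ambient manifold ([smooth_at_sub]).

   The pullback of [E] along the source map of [X] is an embedded submanifold of
   [ar X * E] ([fibre_manifold]): where the bundle is trivialised by
   [(pi, psi)], with inverse [chi], the pullback is parametrised by pairs
   [(gamma, g)] through [(gamma, chi (src gamma, g))]. The same parametrisation
   is used three more times. It shows that the decorated source is a submersion
   ([dec_src_submersion]), as it becomes [(gamma, g) |-> chi (src gamma, g)], a
   submersion followed by a local diffeomorphism; the target is then a
   submersion because inversion exchanges it with the source. It corrects the
   local smooth extensions of the composition of [X] into local smooth
   extensions of the decorated composition ([dec_comp_smooth]). And, with the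
   decoration added, it trivialises the bundle of arrows
   ([dec_arrow_bundle]). *)

(** * Calculus of C^k maps *)

Section ScaleBilinear.
Variables (R : realType) (W : normedModType R).

Definition scale_map (a : R) (w : W) : W := a *: w.

Lemma scale_is_bilinear :
  bilinear_for
    (GRing.Scale.Law.clone _ _ *:%R _) (GRing.Scale.Law.clone _ _ *:%R _)
    scale_map.
Proof.
split=> [u'|u] a x y /=; rewrite /scale_map; first by rewrite scalerDl scalerA.
by rewrite scalerDr !scalerA mulrC.
Qed.

HB.instance Definition _ := bilinear_isBilinear.Build R R W W _ _
  scale_map scale_is_bilinear.

Variable V : normedModType R.
Implicit Types (a : V -> R) (f : V -> W).

Lemma differentiable_scale a f x : differentiable a x -> differentiable f x ->
  differentiable (fun y => a y *: f y) x.
Proof.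
move=> da df.
apply: (@differentiable_comp _ _ _ _ (fun y => (a y, f y))
  (fun p : R * W => p.1 *: p.2)); first exact: differentiable_pair.
apply: (@differentiable_bilin _ _ _ _ scale_map).
exact: scale_continuous.
Qed.

Lemma derive_scale a f x v : differentiable a x -> differentiable f x ->
  'D_v (fun y => a y *: f y) x = a x *: 'D_v f x + 'D_v a x *: f x.
Proof.
move=> da df; rewrite !deriveE //; last exact: differentiable_scale.
have dp := differentiable_pair da df.
have cs : continuous (fun p : R * W => p.1 *: p.2) by exact: scale_continuous.
have db := @differentiable_bilin R R W W scale_map
  (a x, f x) cs.
rewrite (@diff_comp _ _ _ _ (fun y => (a y, f y)) (fun p : R * W => p.1 *: p.2)
  x dp db) /= diff_pair //.
by rewrite (@diff_bilin _ _ _ _ scale_map).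
Qed.

End ScaleBilinear.


Lemma near_eq_differentiable (R : realType) (V W : normedModType R)
    (f g : V -> W) (x : V) : (\forall y \near x, f y = g y) ->
  differentiable f x -> differentiable g x.
Proof.
move=> fg /diff_locallyP[dfc dfo].
have fgx : f x = g x := nbhs_singleton fg.
have dgo : g \o shift x = cst (g x) + 'd f x +o_ (0 : V) id.
  apply/eqaddoP => e e0; move/eqaddoP: dfo => /(_ e e0) dfo.
  have fg0 := fg; rewrite (near_shift 0 x) in fg0.
  apply: (@filterS2 _ _ (nbhs_filter 0) _ _ _ _ fg0 dfo) => h /=.
  rewrite subr0 => fgh.
  by rewrite /= !fctE /= fgh fgx.
apply/diff_locallyP; split.
  by rewrite (diff_unique dfc dgo).
by rewrite (diff_unique dfc dgo).
Qed.

Definition rV_coord (R : realType) n (i : 'I_n) (v : 'rV[R]_n) : R := v 0 i.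

Fact rV_coord_is_linear (R : realType) n (i : 'I_n) : linear (@rV_coord R n i).
Proof. by move=> a u v; rewrite /rV_coord !mxE. Qed.

HB.instance Definition _ (R : realType) n (i : 'I_n) :=
  GRing.isLinear.Build R 'rV[R]_n R _ (@rV_coord R n i)
    (@rV_coord_is_linear R n i).

Lemma row_mx_linear (R : realType) (T : Type) n m (f : T -> 'rV[R]_n)
    (g : T -> 'rV[R]_m) :
  (fun y => row_mx (f y) (g y)) =
  (mulmxr (row_mx 1%:M 0) \o f) \+ (mulmxr (row_mx 0 1%:M) \o g).
Proof.
apply/funext => y /=; rewrite !mul_mx_row !mulmx1 !mulmx0.
by rewrite add_row_mx addr0 add0r.
Qed.

Section Ck.
Variable R : realType.
Implicit Types V W : normedModType R.

Lemma CkS V W k (U : set V) (f : V -> W) : Ck k.+1 U f -> Ck k U f.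
Proof.
elim: k f => [|k IH] f [df Df] => /=.
  by move=> x Ux; apply: differentiable_continuous; apply: df.
by split=> // v; apply: IH.
Qed.

Lemma Ck_sub V W k (U U' : set V) (f : V -> W) : U' `<=` U ->
  Ck k U f -> Ck k U' f.
Proof.
move=> sU; elim: k f => [|k IH] f /=; first by move=> cf x /sU /cf.
by case=> df Df; split=> [x /sU /df //|v]; apply: IH.
Qed.

(** Every clause of [Ck] is about one point at a time. *)
Lemma Ck_local V W k (U : set V) (f : V -> W) :
  (forall x, U x -> exists U', U' x /\ Ck k U' f) -> Ck k U f.
Proof.
elim: k f => [|k IH] f loc /=.
  by move=> x /loc [U' [U'x cf]]; apply: cf.
split=> [x /loc [U' [U'x [df _]]]|v]; first exact: df.
by apply: IH => x /loc [U' [U'x [_ Df]]]; exists U'; split=> //; apply: Df.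
Qed.

Lemma Ck_eq V W k (U : set V) (f g : V -> W) : open U ->
  (forall x, U x -> f x = g x) -> Ck k U f -> Ck k U g.
Proof.
move=> oU; have ne (h h' : V -> W) x : U x -> (forall x, U x -> h x = h' x) ->
  \forall y \near x, h y = h' y.
  by move=> Ux hh; apply: (filterS hh); apply: open_nbhs_nbhs.
elim: k f g => [|k IH] f g fg /=.
  move=> cf x Ux; have cfx : f @ x --> f x := cf x Ux.
  suff: g @ x --> g x by [].
  rewrite -(fg x Ux); apply: cvg_trans cfx.
  by apply: near_eq_cvg; apply: ne.
case=> df Df; split=> [x Ux|v]; last first.
  by apply: IH (Df v) => x Ux; apply: near_eq_derive; apply: ne.
by apply: near_eq_differentiable (df x Ux); apply: ne.
Qed.

Lemma Ck_cst V W k (U : set V) (w : W) : Ck k U (cst w).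
Proof.
elim: k w => [|k IH] w /=; first by move=> x _; apply: cst_continuous.
split=> [x _|v]; first exact: differentiable_cst.
by rewrite (_ : 'D_v _ = cst 0) //; apply/funext => x; rewrite derive_cst.
Qed.

Lemma Ck_add V W k (U : set V) (f g : V -> W) : open U ->
  Ck k U f -> Ck k U g -> Ck k U (f \+ g).
Proof.
move=> oU; elim: k f g => [|k IH] f g /=.
  by move=> cf cg x Ux; apply: cvgD; [exact: cf|exact: cg].
move=> [df Df] [dg Dg]; split=> [x Ux|v].
  by apply: differentiableD; [exact: df|exact: dg].
apply: (@Ck_eq _ _ _ _ ('D_v f \+ 'D_v g)) => //; last exact: IH.
move=> x Ux; rewrite -[f \+ g]/(f + g) deriveD //.
  by apply: diff_derivable; exact: df.
by apply: diff_derivable; exact: dg.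
Qed.

Lemma Ck_sum V W k (U : set V) n (f : 'I_n -> V -> W) : open U ->
  (forall i, Ck k U (f i)) -> Ck k U (fun x => \sum_i f i x).
Proof.
move=> oU; elim: n f => [|n IH] f Cf.
  by under eq_fun do rewrite big_ord0; apply: Ck_cst.
under eq_fun do rewrite big_ord_recl.
by apply: Ck_add => //; apply: IH.
Qed.

Lemma Ck_scale V W k (U : set V) (a : V -> R) (f : V -> W) : open U ->
  Ck k U a -> Ck k U f -> Ck k U (fun x => a x *: f x).
Proof.
move=> oU; elim: k a f => [|k IH] a f.
  by move=> ca cf x Ux; apply: cvgZ; [exact: ca|exact: cf].
move=> Ca Cf; have [[da Da] [df Df]] := (Ca, Cf); split=> [x Ux|v].
  by apply: differentiable_scale; [exact: da|exact: df].
apply: (@Ck_eq _ _ _ _ ((fun x => a x *: 'D_v f x) \+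
  (fun x => 'D_v a x *: f x))) => //.
  by move=> x Ux; rewrite derive_scale //; [exact: da|exact: df].
apply: Ck_add => //; apply: IH.
- exact: CkS Ca.
- exact: Df.
- exact: Da.
- exact: CkS Cf.
Qed.

(** A linear map is a combination of coordinates with constant coefficients. *)
Lemma linear_rV_continuous W n (f : {linear 'rV[R]_n -> W}) : continuous f.
Proof.
have -> : (f : _ -> _) = fun x => \sum_i x 0 i *: f (delta_mx 0 i).
  apply/funext => y; rewrite {1}[y]row_sum_delta linear_sum /=.
  by apply: eq_bigr => i _; rewrite linearZ.
have : Ck 0 setT (fun x : 'rV[R]_n => \sum_i x 0 i *: f (delta_mx 0 i)).
  apply: Ck_sum => [|i]; first exact: openT.
  apply: Ck_scale; first exact: openT.
    by move=> x _; exact: coord_continuous.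
  exact: Ck_cst.
by move=> cf x; exact: cf.
Qed.

Lemma Ck_linear_comp V W W' k (U : set V) (f : V -> W) (L : {linear W -> W'}) :
  open U -> continuous L -> Ck k U f -> Ck k U (L \o f).
Proof.
move=> oU cL; have dL y : differentiable L y by exact: linear_differentiable.
elim: k f => [|k IH] f /=.
  by move=> cf x Ux; apply: continuous_comp; [exact: cf|exact: cL].
move=> [df Df]; split=> [x Ux|v].
  by apply: differentiable_comp; [exact: df|exact: dL].
apply: (@Ck_eq _ _ _ _ (L \o 'D_v f)) => //; last exact: IH.
move=> x Ux; have dfx := df x Ux.
have dLf : differentiable (L \o f) x by exact: differentiable_comp.
by rewrite (deriveE v dLf) (diff_comp dfx (dL _)) /= diff_lin // deriveE.
Qed.

Lemma Ck_linear V W k (U : set V) (L : {linear V -> W}) :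
  continuous L -> Ck k U L.
Proof.
move=> cL; case: k => [|k] /=; first by move=> x _; exact: cL.
split=> [x _|v]; first exact: linear_differentiable.
rewrite (_ : 'D_v L = cst (L v)); first exact: Ck_cst.
apply/funext => x; rewrite deriveE ?diff_lin //.
exact: linear_differentiable.
Qed.

(** The derivative of a composite is the sum over the coordinates of the middle
   space of a coordinate of the derivative of the inner map times a partial
   derivative of the outer one; both factors are C^k by induction. *)
Lemma Ck_comp V W n k (U : set V) (U' : set 'rV[R]_n) (f : V -> 'rV[R]_n)
    (g : 'rV[R]_n -> W) : open U -> (forall x, U x -> U' (f x)) ->
  Ck k U f -> Ck k U' g -> Ck k U (g \o f).
Proof.
move=> oU UU'; elim: k f g UU' => [|k IH] f g UU'.
  move=> cf cg x Ux; apply: continuous_comp; first exact: cf.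
  exact/cg/UU'.
move=> Cf Cg; have [[df Df] [dg Dg]] := (Cf, Cg); split=> [x Ux|v].
  by apply: differentiable_comp; [exact: df|exact/dg/UU'].
apply: (@Ck_eq _ _ _ _ (fun x => \sum_i
    'D_v f x 0 i *: ('D_(delta_mx 0 i) g \o f) x)) => //.
  move=> x Ux; have [dfx dgx] := (df _ Ux, dg _ (UU' _ Ux)).
  have dgf : differentiable (g \o f) x by exact: differentiable_comp.
  rewrite (deriveE v dgf) (diff_comp dfx dgx) /= -(deriveE v dfx).
  rewrite [in RHS](row_sum_delta ('D_v f x)) linear_sum.
  by apply: eq_bigr => i _; rewrite linearZ /= (deriveE _ dgx).
apply: Ck_sum => // i; apply: Ck_scale => //; last first.
  by apply: IH; [exact: UU'|exact: CkS Cf|exact: Dg].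
apply: (@Ck_linear_comp _ _ _ _ _ ('D_v f) (rV_coord i)) => //.
  exact: coord_continuous.
exact: Df.
Qed.

End Ck.

(** The condition that [smooth_at] imposes on local representatives. *)
Definition Cinfty_at (R : realType) (V W : normedModType R) (f : V -> W)
  (x : V) : Prop := exists U, [/\ open U, U x & Cinfty U f].

Section CinftyAt.
Variable R : realType.
Implicit Types V W : normedModType R.

Lemma Cinfty_at_continuous V W (f : V -> W) x :
  Cinfty_at f x -> {for x, continuous f}.
Proof. by move=> [U [_ Ux /(_ 0%N)]]; apply. Qed.

Lemma Cinfty_at_differentiable V W (f : V -> W) x :
  Cinfty_at f x -> differentiable f x.
Proof. by move=> [U [_ Ux /(_ 1%N) []]] df _; apply: df. Qed.

Lemma Cinfty_at_eq V W (f g : V -> W) x : (\forall y \near x, f y = g y) ->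
  Cinfty_at f x -> Cinfty_at g x.
Proof.
move=> fg; have : nbhs x [set y | f y = g y] := fg.
rewrite nbhsE => -[A [oA Ax] Afg] [U [oU Ux Cf]].
exists (U `&` A); split=> // [|k]; first exact: openI.
apply: (@Ck_eq _ _ _ _ _ f); first exact: openI.
  by move=> y [_ /Afg].
by apply: (Ck_sub _ (Cf k)) => y [].
Qed.

Lemma Cinfty_local V W (U : set V) (f : V -> W) :
  (forall x, U x -> Cinfty_at f x) -> Cinfty U f.
Proof.
move=> Cf k; apply: Ck_local => x /Cf [U' [_ U'x CU']].
by exists U'; split.
Qed.

Lemma Cinfty_at_cst V W (w : W) (x : V) : Cinfty_at (cst w) x.
Proof. by exists setT; split=> //; [exact: openT|move=> k; exact: Ck_cst]. Qed.

Lemma Cinfty_at_linear V W (L : {linear V -> W}) x :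
  continuous L -> Cinfty_at L x.
Proof.
move=> cL; exists setT; split=> //; first exact: openT.
by move=> k; exact: Ck_linear.
Qed.

Lemma Cinfty_at_add V W (f g : V -> W) x :
  Cinfty_at f x -> Cinfty_at g x -> Cinfty_at (f \+ g) x.
Proof.
move=> [U [oU Ux Cf]] [U' [oU' Ux' Cg]]; exists (U `&` U').
split=> // [|k]; first exact: openI.
apply: Ck_add; first exact: openI.
  by apply: (Ck_sub _ (Cf k)) => y [].
by apply: (Ck_sub _ (Cg k)) => y [].
Qed.

Lemma Cinfty_at_comp V W n (f : V -> 'rV[R]_n) (g : 'rV[R]_n -> W) x :
  Cinfty_at f x -> Cinfty_at g (f x) -> Cinfty_at (g \o f) x.
Proof.
move=> [U [oU Ux Cf]] [U' [oU' U'fx Cg]].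
have oUU' : open (U `&` f @^-1` U').
  rewrite openE => y [Uy U'fy]; apply: filterI; first exact: open_nbhs_nbhs.
  by apply: (Cf 0%N) => //; apply: open_nbhs_nbhs.
exists (U `&` f @^-1` U'); split=> // k.
apply: (@Ck_comp _ _ _ _ _ _ U') => // [y [] //|].
by apply: (Ck_sub _ (Cf k)) => y [].
Qed.

Lemma Cinfty_at_row_mx V n m (f : V -> 'rV[R]_n) (g : V -> 'rV[R]_m) x :
  Cinfty_at f x -> Cinfty_at g x -> Cinfty_at (fun y => row_mx (f y) (g y)) x.
Proof.
move=> Cf Cg.
rewrite row_mx_linear.
apply: Cinfty_at_add; apply: Cinfty_at_comp => //; apply: Cinfty_at_linear;
  exact: linear_rV_continuous.
Qed.

Lemma Cinfty_at_lsubmx n m (x : 'rV[R]_(n + m)) :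
  Cinfty_at (fun v => lsubmx v) x.
Proof. apply: Cinfty_at_linear; exact: linear_rV_continuous. Qed.

Lemma Cinfty_at_rsubmx n m (x : 'rV[R]_(n + m)) :
  Cinfty_at (fun v => rsubmx v) x.
Proof. apply: Cinfty_at_linear; exact: linear_rV_continuous. Qed.

End CinftyAt.

(** * Manifolds and smooth maps *)

(** The part of the definition of a manifold on which smoothness of maps
   depends. Unlike the Hausdorff and countability conditions, it is available
   for the model spaces by inspection. *)
Definition smooth_atlas (R : realType) (M : premanifoldType R) : Prop :=
  [/\ forall c : chart R M, atlas c -> is_chart c,
      forall x : M, exists2 c : chart R M, atlas c & cdom c x
    & forall c d : chart R M, atlas c -> atlas d ->
        Cinfty (cmap c @` (cdom c `&` cdom d)) (cmap d \o cinv c)].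

Lemma manifold_atlas (R : realType) (M : premanifoldType R) :
  is_manifold M -> smooth_atlas M.
Proof. by case. Qed.

Section Charts.
Variables (R : realType) (M : topologicalType) (c : chart R M).
Hypothesis hc : is_chart c.

Lemma cdom_nbhs x : cdom c x -> nbhs x (cdom c).
Proof. by case: hc => oc _ _ _ _ cx; apply: open_nbhs_nbhs. Qed.

Lemma cmapK x : cdom c x -> cinv c (cmap c x) = x.
Proof. by case: hc => _ _ + _ _; apply. Qed.

Lemma cinvK v : cimg c v -> cmap c (cinv c v) = v.
Proof. by case=> x cx <-; rewrite cmapK. Qed.

Lemma cinv_cdom v : cimg c v -> cdom c (cinv c v).
Proof. by case=> x cx <-; rewrite cmapK. Qed.

Lemma cimg_nbhs x : cdom c x -> nbhs (cmap c x) (cimg c).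
Proof.
by case: hc => _ oc _ _ _ cx; apply: open_nbhs_nbhs; split=> //; exists x.
Qed.

Lemma cmap_continuous x : cdom c x -> {for x, continuous (cmap c)}.
Proof. by case: hc => _ _ _ + _; apply. Qed.

Lemma cinv_cvg x : cdom c x -> cinv c @ cmap c x --> x.
Proof.
move=> cx; rewrite -[X in _ --> X](cmapK cx).
by case: hc => _ _ _ _; apply; exists x.
Qed.

Lemma chart_near x (A : set M) : cdom c x -> nbhs x A ->
  \forall v \near cmap c x, cimg c v /\ A (cinv c v).
Proof.
by move=> cx Ax; apply: filterI; [exact: cimg_nbhs|exact: (cinv_cvg cx)].
Qed.

Lemma chart_open (A : set M) : (forall x, A x -> cdom c x) -> open A ->
  open (cmap c @` A).
Proof.
move=> sA oA; rewrite openE => _ [x Ax <-].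
have := chart_near (sA _ Ax) (open_nbhs_nbhs (conj oA Ax)).
by apply: filterS => v [cv Av]; exists (cinv c v); rewrite ?cinvK.
Qed.

End Charts.

Section SmoothMaps.
Variable R : realType.
Implicit Types M N P : premanifoldType R.

Lemma smooth_at_continuous M N (f : M -> N) x : smooth_at f x ->
  {for x, continuous f}.
Proof. by case. Qed.

Lemma smooth_at_rep M N (f : M -> N) x (c : chart R M) (d : chart R N) :
  smooth_at f x -> atlas c -> atlas d -> cdom c x -> cdom d (f x) ->
  Cinfty_at (local_rep c d f) (cmap c x).
Proof. by case=> _; apply. Qed.

Lemma atlas_transition M (c d : chart R M) x : smooth_atlas M ->
  atlas c -> atlas d -> cdom c x -> cdom d x ->
  Cinfty_at (cmap d \o cinv c) (cmap c x).
Proof.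
move=> [hM _ tM] cM dM cx dx; exists (cmap c @` (cdom c `&` cdom d)); split.
- have [oc _ _ _ _] := hM c cM; have [od _ _ _ _] := hM d dM.
  by apply: chart_open; [exact: hM|move=> y []|exact: openI].
- by exists x.
- exact: tM.
Qed.

Lemma smooth_at_eq M N (f g : M -> N) x : smooth_atlas M ->
  (\forall y \near x, f y = g y) -> smooth_at f x -> smooth_at g x.
Proof.
move=> [hM _ _] fg [cf sf]; have fgx : f x = g x := nbhs_singleton fg.
split.
  suff: g @ x --> g x by [].
  have cfx : f @ x --> f x := cf.
  by rewrite -fgx; apply: cvg_trans cfx; apply: near_eq_cvg.
move=> c d cM dN cx dgx.
have hc := hM c cM; have dfx : cdom d (f x) by rewrite fgx.
apply: Cinfty_at_eq (sf c d cM dN cx dfx).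
by apply: filterS (chart_near hc cx fg) => v [_ fgv]; rewrite /local_rep /= fgv.
Qed.

(** The two sides may differ at points that [f] sends outside the chart [d], hence
   the restriction to a neighbourhood. *)
Lemma local_rep_comp_near M N P (f : M -> N) (g : N -> P) x
    (c : chart R M) (d : chart R N) (e : chart R P) :
    is_chart c -> is_chart d -> cdom c x -> cdom d (f x) ->
    {for x, continuous f} ->
  \forall v \near cmap c x,
    (local_rep d e g \o local_rep c d f) v = local_rep c e (g \o f) v.
Proof.
move=> hc hd cx dfx cf.
have := chart_near hc cx (cf _ (cdom_nbhs hd dfx)).
by apply: filterS => v [_ dfv]; rewrite /local_rep /= cmapK.
Qed.

Lemma smooth_at_comp M N P (f : M -> N) (g : N -> P) x :
  smooth_atlas M -> smooth_atlas N ->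
  smooth_at f x -> smooth_at g (f x) -> smooth_at (g \o f) x.
Proof.
move=> [hM _ _] [hN cN _] sf sg; split.
  by apply: continuous_comp; [case: sf|case: sg].
move=> c e cM eP cx egx; have [d dN dfx] := cN (f x).
have nr := local_rep_comp_near g e (hM c cM) (hN d dN) cx dfx sf.1.
apply: (Cinfty_at_eq nr); apply: Cinfty_at_comp; first exact: sf.2.
have -> : local_rep c d f (cmap c x) = cmap d (f x).
  by rewrite /local_rep /= cmapK //; exact: hM.
exact: sg.2.
Qed.

Lemma smooth_at_id M x : smooth_atlas M -> smooth_at (@id M) x.
Proof.
move=> hM; split=> [|c d cM dM cx dx]; first exact: cvg_id.
exact: atlas_transition.
Qed.

Lemma smooth_at_cst M N (y : N) (x : M) : smooth_at (fun=> y) x.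
Proof.
split=> [|c d cM dM cx dx]; first exact: cst_continuous.
exact: Cinfty_at_cst.
Qed.

Lemma rV_atlas n : smooth_atlas 'rV[R]_n.
Proof.
have idC : cimg (id_chart R n) = setT.
  by apply/seteqP; split=> // v _; exists v.
split=> [_ ->|v|_ _ -> ->]; last 2 first.
- by exists (id_chart R n).
- apply: Cinfty_local => v _; apply: (@Cinfty_at_linear _ _ _ idfun).
  exact: linear_rV_continuous.
split=> //; rewrite ?idC; try exact: openT.
- by move=> v _; exact: cvg_id.
- by move=> v _; exact: cvg_id.
Qed.

Lemma cmap_smooth M (c : chart R M) x : smooth_atlas M -> atlas c ->
  cdom c x -> smooth_at (cmap c) x.
Proof.
move=> hM cM cx; split.
  by apply: cmap_continuous => //; case: hM => + _ _; apply.
move=> d _ dM -> dx _; exact: atlas_transition.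
Qed.

Lemma cinv_smooth M (c : chart R M) v : smooth_atlas M -> atlas c ->
  cimg c v -> smooth_at (cinv c) v.
Proof.
move=> hM cM [x cx <-]; have hc : is_chart c by case: hM => + _ _; apply.
split; first by case: hc => _ _ _ _; apply; exists x.
move=> _ d -> dM _ /=; rewrite cmapK // => dx; exact: atlas_transition.
Qed.

Lemma smooth_at_rV n m (f : 'rV[R]_n -> 'rV[R]_m) v :
  smooth_at f v <-> Cinfty_at f v.
Proof.
split=> [[_ /(_ (id_chart R n) (id_chart R m))]|Cf]; first by apply.
by split=> [|_ _ -> -> _ _]; [exact: Cinfty_at_continuous|].
Qed.

End SmoothMaps.

(** * Products *)

Section ProductTopology.

Lemma prod_hausdorff (T U : topologicalType) :
  hausdorff_space T -> hausdorff_space U -> hausdorff_space (T * U)%type.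
Proof.
move=> hT hU [a b] [a' b'] cl.
have ct (S : topologicalType) (f : T * U -> S) (x y : T * U) :
    continuous f -> cluster (nbhs x) y -> cluster (nbhs (f x)) (f y).
  move=> cf clxy A B /cf Ax /cf By.
  by have [z [Az Bz]] := clxy _ _ Ax By; exists (f z).
congr (_, _).
  by apply: hT; apply: (ct _ fst _ _ _ cl) => ?; exact: cvg_fst.
by apply: hU; apply: (ct _ snd _ _ _ cl) => ?; exact: cvg_snd.
Qed.

Lemma prod_second_countable (T U : topologicalType) :
  @second_countable T -> @second_countable U -> @second_countable (T * U)%type.
Proof.
move=> [B cB [oB bB]] [C cC [oC bC]].
exists [set D | exists2 AB, (B `*` C) AB & D = AB.1 `*` AB.2].
  apply: (@sub_countable _ _ _
    ((fun AB : set T * set U => AB.1 `*` AB.2) @` (B `*` C))).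
    by apply: subset_card_le => _ [AB BC ->]; exists AB.
  by apply: card_le_trans (card_image_le _ _) _; exact: countableX.
split=> [_ [[A A'] [/= /oB oA /oC oA'] ->]|[x y] D].
  rewrite openE => -[x y] [/= Ax A'y].
  by exists (A, A') => //=; split; apply: open_nbhs_nbhs.
case=> -[E F] [/= /bB [A [BA Ax] AE] /bC [A' [CA' A'y] A'F]] EFD.
exists (A `*` A') => [|[u v] [/= /AE Eu /A'F Fv]]; last exact: EFD.
by split=> //; exists (A, A').
Qed.

End ProductTopology.

Section ProductManifold.
Variable R : realType.
Implicit Types M N P : premanifoldType R.

Lemma cimg_prod M N (c : chart R M) (d : chart R N)
    (v : 'rV[R]_(cdim c + cdim d)) :
  cimg (prod_chart c d) v <-> cimg c (lsubmx v) /\ cimg d (rsubmx v).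
Proof.
split=> [[[x y] [cx dy] <-]|[[x cx xv] [y dy yv]]] /=.
  by rewrite row_mxKl row_mxKr; split; [exists x|exists y].
by exists (x, y); rewrite //= xv yv hsubmxK.
Qed.

Lemma pair_continuous (S T U : topologicalType) (f : S -> T) (g : S -> U) x :
  {for x, continuous f} -> {for x, continuous g} ->
  {for x, continuous (fun y => (f y, g y))}.
Proof. by move=> cf cg; apply: cvg_pair; [exact: cf|exact: cg]. Qed.

Lemma row_mx_continuous (T : topologicalType) n m (f : T -> 'rV[R]_n)
    (g : T -> 'rV[R]_m) x : {for x, continuous f} -> {for x, continuous g} ->
  {for x, continuous (fun y => row_mx (f y) (g y))}.
Proof.
move=> cf cg.
rewrite row_mx_linear.
apply: cvgD.
  by apply: continuous_comp; [exact: cf|exact: linear_rV_continuous].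
by apply: continuous_comp; [exact: cg|exact: linear_rV_continuous].
Qed.

Lemma prod_is_chart M N (c : chart R M) (d : chart R N) :
  is_chart c -> is_chart d -> is_chart (prod_chart c d).
Proof.
move=> hc hd; split.
- rewrite openE => -[x y] [/= cx dy].
  by exists (cdom c, cdom d) => //=; split; exact: cdom_nbhs.
- rewrite openE => v /cimg_prod [cv dv].
  have cl : \forall w \near v, cimg c (lsubmx w).
    apply: (@continuous_lsubmx R 1 _ _ v); apply: open_nbhs_nbhs; split=> //.
    by case: hc.
  have cr : \forall w \near v, cimg d (rsubmx w).
    apply: (@continuous_rsubmx R 1 _ _ v); apply: open_nbhs_nbhs; split=> //.
    by case: hd.
  by apply: filterS2 cl cr => w cw dw; apply/cimg_prod.
- by move=> [x y] [/= cx dy]; rewrite row_mxKl row_mxKr !cmapK.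
- move=> [x y] [/= cx dy]; apply: row_mx_continuous.
    by apply: continuous_comp; [exact: cvg_fst|exact: cmap_continuous].
  by apply: continuous_comp; [exact: cvg_snd|exact: cmap_continuous].
- move=> v /cimg_prod [cv dv] /=.
  apply: (@pair_continuous _ _ _ (cinv c \o lsubmx) (cinv d \o rsubmx)).
    apply: (@continuous_comp _ _ _ (fun w => lsubmx w) (cinv c) v).
      exact: continuous_lsubmx.
    by case: hc => _ _ _ _; apply.
  apply: (@continuous_comp _ _ _ (fun w => rsubmx w) (cinv d) v).
    exact: continuous_rsubmx.
  by case: hd => _ _ _ _; apply.
Qed.

Lemma prod_atlas M N : smooth_atlas M -> smooth_atlas N ->
  smooth_atlas (M * N)%type.
Proof.
move=> hM hN; have [cM eM tM] := hM; have [cN eN tN] := hN; split.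
- by move=> _ [c [d [/cM hc /cN hd ->]]]; exact: prod_is_chart.
- move=> [x y]; have [c Mc cx] := eM x; have [d Nd dy] := eN y.
  by exists (prod_chart c d) => //; exists c, d.
- move=> _ _ [c [d [Mc Nd ->]]] [c' [d' [Mc' Nd' ->]]].
  apply: Cinfty_local => _ [[x y] [[/= cx dy] [/= c'x d'y]] <-].
  apply: Cinfty_at_row_mx.
    apply: (@Cinfty_at_comp _ _ _ _ (fun v => lsubmx v) (cmap c' \o cinv c)).
      exact: Cinfty_at_lsubmx.
    by rewrite row_mxKl; exact: atlas_transition.
  apply: (@Cinfty_at_comp _ _ _ _ (fun v => rsubmx v) (cmap d' \o cinv d)).
    exact: Cinfty_at_rsubmx.
  by rewrite row_mxKr; exact: atlas_transition.
Qed.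

Lemma prod_manifold M N : is_manifold M -> is_manifold N ->
  is_manifold (M * N)%type.
Proof.
move=> mM mN.
have [||h1 h2 h3] := @prod_atlas M N; [exact: manifold_atlas..|].
case: mM mN => [[hM sM] _ _ _] [[hN sN] _ _ _]; split=> //.
by split; [exact: prod_hausdorff|exact: prod_second_countable].
Qed.

Lemma smooth_at_fst M N (x : M * N) : smooth_atlas M -> smooth_atlas N ->
  smooth_at (fun y : M * N => y.1) x.
Proof.
move=> hM hN; split=> [|_ e [c [d [Mc Nd ->]]] Me [/= cx _] ex].
  exact: cvg_fst.
apply: (@Cinfty_at_comp _ _ _ _ (fun v => lsubmx v) (cmap e \o cinv c)).
  exact: Cinfty_at_lsubmx.
by rewrite row_mxKl; exact: atlas_transition.
Qed.

Lemma smooth_at_snd M N (x : M * N) : smooth_atlas M -> smooth_atlas N ->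
  smooth_at (fun y : M * N => y.2) x.
Proof.
move=> hM hN; split=> [|_ e [c [d [Mc Nd ->]]] Me [/= _ dx] ex].
  exact: cvg_snd.
apply: (@Cinfty_at_comp _ _ _ _ (fun v => rsubmx v) (cmap e \o cinv d)).
  exact: Cinfty_at_rsubmx.
by rewrite row_mxKr; exact: atlas_transition.
Qed.

Lemma smooth_at_pair M N P (f : M -> N) (g : M -> P) x :
  smooth_at f x -> smooth_at g x -> smooth_at (fun y => (f y, g y)) x.
Proof.
move=> sf sg; split; first by apply: cvg_pair; [case: sf|case: sg].
move=> c _ Mc [d [e [Nd Pe ->]]] cx [/= dx ex].
by apply: Cinfty_at_row_mx; [exact: sf.2|exact: sg.2].
Qed.

End ProductManifold.

(** * Embedded submanifolds *)

Section SubTopology.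
Variables (T : topologicalType) (A : set T).

Lemma sub_val_continuous : continuous (val : set_type A -> T).
Proof. exact: (@initial_continuous _ _ (val : set_type A -> T)). Qed.

Lemma sub_nbhs (x : set_type A) (D : set (set_type A)) : nbhs x D ->
  exists B : set T, [/\ open B, B (val x) & val @^-1` B `<=` D].
Proof.
rewrite nbhsE => -[_ [[B oB <-] Bx] BD]; exists B; split=> //.
Qed.

Lemma sub_continuous (S : topologicalType) (f : S -> set_type A) x :
  {for x, continuous (val \o f)} -> {for x, continuous f}.
Proof.
move=> cf D /sub_nbhs [B [oB Bfx BD]].
have nB : nbhs ((val \o f) x) B by apply: open_nbhs_nbhs.
have : nbhs x ((val \o f) @^-1` B) := cf B nB.
by apply: filterS => y /BD.
Qed.

Lemma sub_hausdorff : hausdorff_space T -> hausdorff_space (set_type A).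
Proof.
move=> hT x y cl; apply: val_inj; apply: hT => B C xB yC.
have [z [Bz Cz]] := cl _ _ (sub_val_continuous xB) (sub_val_continuous yC).
by exists (val z).
Qed.

Lemma sub_second_countable : @second_countable T ->
  @second_countable (set_type A).
Proof.
move=> [B cB [oB bB]]; exists ((fun C => val @^-1` C) @` B).
  exact: card_le_trans (card_image_le _ _) cB.
split=> [_ [C /oB oC <-]|x D /sub_nbhs [C [oC Cx CD]]].
  by apply: open_comp => // y _; exact: sub_val_continuous.
have [E [BE Ex] EC] := bB (val x) C (open_nbhs_nbhs (conj oC Cx)).
exists (val @^-1` E) => [|y Ey]; first by split=> //; exists E.
exact/CD/EC.
Qed.

End SubTopology.

Section Submanifold.
Variables (R : realType) (M : premanifoldType R) (A : set M).
Hypothesis hM : smooth_atlas M.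

(** By definition, charts of [A] have inverses that are smooth into [M]. *)
Lemma smooth_at_val (x : set_type A) : smooth_at (val : set_type A -> M) x.
Proof.
split=> [|c d [hc _ ci] Md cx dx]; first exact: sub_val_continuous.
have [|_ /(_ (id_chart R _) d)] := ci (cmap c x); first by exists x.
by apply=> //=; rewrite (cmapK hc).
Qed.

(** A chart of [A] extends to a smooth map [F] on an open subset of [M], so that
   the representative of [f] is locally that of [F \o val \o f]. *)
Lemma smooth_at_sub (N : premanifoldType R) (f : N -> set_type A) x :
  smooth_atlas N -> smooth_at (val \o f) x -> smooth_at f x.
Proof.
move=> hN sf; have cf : {for x, continuous f}.
  by apply: sub_continuous; case: sf.
split=> // c d Nc [hd ds _] cx dfx.
have [F [W [oW Wfx sF FE]]] := ds _ dfx.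
have hc : is_chart c by case: hN => + _ _; apply.
have sFf : smooth_at (F \o (val \o f)) x.
  by apply: smooth_at_comp => //; exact: sF.
have Wnear : \forall y \near x, W (val (f y)).
  by case: sf => + _; apply; apply: open_nbhs_nbhs.
apply: Cinfty_at_eq (sFf.2 c (id_chart R _) Nc erefl cx I).
apply: filterS (chart_near hc cx Wnear) => v [_ Wv].
by rewrite /local_rep /= FE.
Qed.

Hypothesis charts : forall x : set_type A,
  exists2 c : chart R (set_type A), atlas c & cdom c x.

Lemma sub_atlas_smooth : smooth_atlas (set_type A).
Proof.
split=> // [c [] //|c d Ac Ad]; apply: Cinfty_local => _ [x [cx dx] <-].
have [hc cs ci] := Ac; have [hd ds _] := Ad.
apply/smooth_at_rV; have [F [W [oW Wx sF FE]]] := ds _ dx.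
have si : smooth_at (val \o cinv c) (cmap c x) by apply: ci; exists x.
have cx' : (val \o cinv c) (cmap c x) = val x by rewrite /= cmapK.
apply: (@smooth_at_eq _ _ _ (F \o (val \o cinv c))); first exact: rV_atlas.
  have : \forall v \near cmap c x, W (val (cinv c v)).
    by case: si => + _; apply; apply: open_nbhs_nbhs; rewrite cx'.
  by apply: filterS => v Wv; rewrite /= FE.
by apply: smooth_at_comp => //; [exact: rV_atlas|apply: sF; rewrite cx'].
Qed.

Lemma smooth_sub_smooth (N : premanifoldType R) (f : set_type A -> N) :
  smooth_sub f -> smooth f.
Proof.
move=> sf x; have [F [W [oW Wx sF FE]]] := sf x.
apply: (@smooth_at_eq _ _ _ (F \o (val : set_type A -> M))); first exact: sub_atlas_smooth.
  have : \forall y \near x, W (val y).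
    by apply: sub_val_continuous; apply: open_nbhs_nbhs.
  by apply: filterS => y Wy; rewrite /= FE.
apply: smooth_at_comp => //; [exact: sub_atlas_smooth|exact: smooth_at_val|].
exact: sF.
Qed.

Lemma sub_manifold : is_manifold M -> is_manifold (set_type A).
Proof.
move=> [[h2 c2] _ _ _]; have [h3 h4 h5] := sub_atlas_smooth.
by split=> //; split; [exact: sub_hausdorff|exact: sub_second_countable].
Qed.

End Submanifold.

(** * Submersions *)

(** Surjectivity of the differential at one point, so that submersions can be
   recognised from maps that are only defined or smooth near it. *)
Definition submersive_at (R : realType) (M N : premanifoldType R) (f : M -> N)
    (x : M) : Prop :=
  forall (c : chart R M) (d : chart R N), atlas c -> atlas d ->
    cdom c x -> cdom d (f x) ->
    forall w, exists v, 'd (local_rep c d f) (cmap c x) v = w.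

Section Submersions.
Variable R : realType.
Implicit Types M N P Q : premanifoldType R.

Lemma near_eq_diff (V W : normedModType R) (f g : V -> W) (x v : V) :
  (\forall y \near x, f y = g y) -> differentiable f x ->
  'd f x v = 'd g x v.
Proof.
move=> fg df; have dg := near_eq_differentiable fg df.
by rewrite -!deriveE //; exact: near_eq_derive.
Qed.

Lemma diff_local_rep_comp M N P (f : M -> N) (g : N -> P) x
    (c : chart R M) (d : chart R N) (e : chart R P) v :
    is_chart c -> is_chart d -> atlas c -> atlas d -> atlas e ->
    cdom c x -> cdom d (f x) -> cdom e (g (f x)) ->
    smooth_at f x -> smooth_at g (f x) ->
  'd (local_rep c e (g \o f)) (cmap c x) v =
  'd (local_rep d e g) (cmap d (f x)) ('d (local_rep c d f) (cmap c x) v).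
Proof.
move=> hc hd Mc Nd Pe cx dfx egfx sf sg.
have fx : local_rep c d f (cmap c x) = cmap d (f x).
  by rewrite /local_rep /= cmapK.
have df : differentiable (local_rep c d f) (cmap c x).
  by apply: Cinfty_at_differentiable; exact: smooth_at_rep.
have dg : differentiable (local_rep d e g) (local_rep c d f (cmap c x)).
  by rewrite fx; apply: Cinfty_at_differentiable; exact: smooth_at_rep.
rewrite -fx -(near_eq_diff v (local_rep_comp_near g e hc hd cx dfx sf.1)).
  by rewrite diff_comp.
exact: differentiable_comp.
Qed.

Lemma submersive_comp M N P (f : M -> N) (g : N -> P) x :
  smooth_atlas M -> smooth_atlas N -> smooth_at f x -> smooth_at g (f x) ->
  submersive_at f x -> submersive_at g (f x) -> submersive_at (g \o f) x.
Proof.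
move=> [hM _ _] [hN cN _] sf sg uf ug c e Mc Pe cx egfx w.
have [d Nd dfx] := cN (f x).
have [v' <-] := ug d e Nd Pe dfx egfx w.
have [v <-] := uf c d Mc Nd cx dfx v'.
by exists v; rewrite (diff_local_rep_comp _ (hM _ Mc) (hN _ Nd)).
Qed.

(** This lets a map be tested in a parametrisation [f] of its source: the range of
   the differential of [g] contains that of [g \o f]. *)
Lemma submersive_cancel M N P (f : M -> N) (g : N -> P) x :
  smooth_atlas M -> smooth_atlas N -> smooth_at f x -> smooth_at g (f x) ->
  submersive_at (g \o f) x -> submersive_at g (f x).
Proof.
move=> [hM cM _] [hN _ _] sf sg u d e Nd Pe dfx egfx w.
have [c Mc cx] := cM x; have [v <-] := u c e Mc Pe cx egfx w.
exists ('d (local_rep c d f) (cmap c x) v).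
by rewrite -(diff_local_rep_comp _ (hM _ Mc) (hN _ Nd)).
Qed.

(** The two charts may differ: a change of charts has an invertible differential,
   by the chain rule applied to it and to the inverse change. *)
Lemma submersive_id M x : smooth_atlas M -> submersive_at (@id M) x.
Proof.
move=> hM c d Mc Md cx dx w; have [cM _ _] := hM.
exists ('d (local_rep d c id) (cmap d x) w).
have := @diff_local_rep_comp _ _ _ id id x d c d w (cM _ Md) (cM _ Mc) Md Mc Md
  dx cx dx (smooth_at_id x hM) (smooth_at_id x hM).
move=> <-; rewrite -(@near_eq_diff _ _ id).
- by rewrite (@diff_lin _ _ _ idfun) //; exact: linear_rV_continuous.
- apply: filterS (cimg_nbhs (cM _ Md) dx) => v dv.
  by rewrite /local_rep /= (cinvK (cM _ Md)).
- apply: (@linear_differentiable _ _ _ idfun); exact: linear_rV_continuous.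
Qed.

Lemma submersive_eq M N (f g : M -> N) x : smooth_atlas M ->
  (\forall y \near x, f y = g y) -> smooth_at f x ->
  submersive_at f x -> submersive_at g x.
Proof.
move=> [hM _ _] fg sf uf c d Mc Nd cx dgx w.
have fgx : f x = g x := nbhs_singleton fg.
have dfx : cdom d (f x) by rewrite fgx.
have [v <-] := uf c d Mc Nd cx dfx w; exists v; symmetry; apply: near_eq_diff.
  apply: filterS (chart_near (hM _ Mc) cx fg) => y [_ fgy].
  by rewrite /local_rep /= fgy.
by apply: Cinfty_at_differentiable; exact: smooth_at_rep.
Qed.

(** [f \o s] is the identity near [f x], so that [submersive_cancel] applies. *)
Lemma submersive_section M N (f : M -> N) (s : N -> M) x :
  smooth_atlas M -> smooth_atlas N -> smooth_at f x -> smooth_at s (f x) ->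
  s (f x) = x -> (\forall y \near f x, f (s y) = y) -> submersive_at f x.
Proof.
move=> hM hN sf ss sx fs; rewrite -sx.
apply: submersive_cancel => //; first by rewrite sx.
apply: (@submersive_eq _ _ id) => //; [|exact: smooth_at_id|exact: submersive_id].
by apply: filterS fs.
Qed.

(** The chain rule for both sides of [L \o F = G \o L']; with projections for [L]
   and [L'], it computes the differential of a product map by components. *)
Lemma diff_intertwine n m n' m' (F : 'rV[R]_n -> 'rV[R]_m)
    (G : 'rV[R]_n' -> 'rV[R]_m') (L : {linear 'rV[R]_m -> 'rV[R]_m'})
    (L' : {linear 'rV[R]_n -> 'rV[R]_n'}) z v :
  L \o F = G \o L' -> differentiable F z -> differentiable G (L' z) ->
  L ('d F z v) = 'd G (L' z) (L' v).
Proof.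
move=> FG dF dG.
have cL : continuous L by exact: linear_rV_continuous.
have cL' : continuous L' by exact: linear_rV_continuous.
have dL : differentiable L (F z) by exact: linear_differentiable.
have dL' : differentiable L' z by exact: linear_differentiable.
rewrite -[LHS]/((L \o 'd F z) v) -{1}(diff_lin (F z) cL) -(diff_comp dF dL) FG.
by rewrite (diff_comp dL' dG) /= (diff_lin z cL').
Qed.

Lemma submersive_prod M N P Q (f : M -> P) (g : N -> Q) (x : M * N) :
  smooth_atlas M -> smooth_atlas N -> smooth_atlas P -> smooth_atlas Q ->
  smooth_at f x.1 -> smooth_at g x.2 ->
  submersive_at f x.1 -> submersive_at g x.2 ->
  submersive_at (fun y : M * N => (f y.1, g y.2)) x.
Proof.
move=> hM hN hP hQ sf sg uf ug _ _ [c [d [Mc Nd ->]]] [c' [d' [Pc' Qd' ->]]].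
case: x sf sg uf ug => x y /= sf sg uf ug [/= cx dy] [/= c'fx d'gy] w.
have [v1 v1E] := uf c c' Mc Pc' cx c'fx (lsubmx w).
have [v2 v2E] := ug d d' Nd Qd' dy d'gy (rsubmx w).
exists (row_mx v1 v2).
set F := local_rep _ _ _; set z := row_mx _ _.
have Cf : Cinfty_at (local_rep c c' f) (lsubmx z).
  by rewrite row_mxKl; exact: smooth_at_rep.
have Cg : Cinfty_at (local_rep d d' g) (rsubmx z).
  by rewrite row_mxKr; exact: smooth_at_rep.
have dF : differentiable F z.
  apply: Cinfty_at_differentiable; apply: Cinfty_at_row_mx.
    apply: (@Cinfty_at_comp _ _ _ _ (fun v => lsubmx v) (local_rep c c' f)) => //.
    exact: Cinfty_at_lsubmx.
  apply: (@Cinfty_at_comp _ _ _ _ (fun v => rsubmx v) (local_rep d d' g)) => //.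
  exact: Cinfty_at_rsubmx.
rewrite -[LHS]hsubmxK -[RHS]hsubmxK; congr row_mx.
  rewrite (@diff_intertwine _ _ _ _ F (local_rep c c' f) lsubmx lsubmx) //.
  - by rewrite /= /z !row_mxKl.
  - by apply/funext => v /=; rewrite /F /local_rep /= row_mxKl.
  - exact: Cinfty_at_differentiable.
rewrite (@diff_intertwine _ _ _ _ F (local_rep d d' g) rsubmx rsubmx) //.
- by rewrite /= /z !row_mxKr.
- by apply/funext => v /=; rewrite /F /local_rep /= row_mxKr.
- exact: Cinfty_at_differentiable.
Qed.

End Submersions.

(** * Fibre products with principal bundles *)

Lemma smooth_at_comp2 (R : realType) (M N P Q : premanifoldType R)
    (h : N * P -> Q) (f : M -> N) (g : M -> P) x :
  smooth_atlas M -> smooth_atlas N -> smooth_atlas P ->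
  smooth_at h (f x, g x) -> smooth_at f x -> smooth_at g x ->
  smooth_at (fun y => h (f y, g y)) x.
Proof.
move=> hM hN hP sh sf sg.
apply: (@smooth_at_comp _ _ _ _ (fun y => (f y, g y)) h) => //.
  exact: prod_atlas.
exact: smooth_at_pair.
Qed.

Lemma smooth_at_row_mx (R : realType) (M : premanifoldType R) n m
    (f : M -> 'rV[R]_n) (g : M -> 'rV[R]_m) x :
  smooth_at f x -> smooth_at g x -> smooth_at (fun y => row_mx (f y) (g y)) x.
Proof.
move=> sf sg; split; first by apply: row_mx_continuous; [case: sf|case: sg].
move=> c _ Mc -> cx _; apply: Cinfty_at_row_mx.
  exact: (sf.2 c (id_chart R n)).
exact: (sg.2 c (id_chart R m)).
Qed.

Section LiftFibre.
Variables (A B C : Type) (f : A -> C) (g : B -> C).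

(** Inverses of charts and of trivialisations are total functions; [x0] is the
   value taken outside the fibre product. *)
Definition lift_fib (x0 : set_type (fibre f g)) (a : A) (b : B) :
    set_type (fibre f g) :=
  if pselect (f a = g b) is left e then fib e else x0.

Lemma lift_fibE x0 a b : f a = g b -> val (lift_fib x0 a b) = (a, b).
Proof. by rewrite /lift_fib; case: pselect. Qed.

Lemma fib_val (x : set_type (fibre f g)) : f (val x).1 = g (val x).2.
Proof. by have /set_mem := valP x. Qed.

Lemma lift_fib_val x0 (x : set_type (fibre f g)) a b : (val x).1 = a -> (val x).2 = b ->
  lift_fib x0 a b = x.
Proof.
move=> <- <-; apply: val_inj; rewrite lift_fibE ?fib_val //.
by case: (val x).
Qed.

End LiftFibre.

Section FibreProduct.
Variables (R : realType) (G : preLieGroupType R) (M N E : premanifoldType R).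
Variables (s : M -> N) (pi : E -> N) (act : E * G -> E).
Hypothesis hM : is_manifold M.
Hypothesis hE : is_principal_bundle pi act.
Hypothesis ss : smooth s.

Let aM : smooth_atlas M. Proof. exact: manifold_atlas. Qed.
Let aE : smooth_atlas E.
Proof. by apply: manifold_atlas; case: hE. Qed.
Let aN : smooth_atlas N.
Proof. by apply: manifold_atlas; case: hE. Qed.
Let aG : smooth_atlas G.
Proof. by apply: manifold_atlas; case: hE => -[]. Qed.

Section Chart.
Variables (c : chart R M) (d : chart R G) (U : set N) (psi : E -> G).
Variables (chi : N * G -> E) (x0 : set_type (fibre s pi)).
Hypotheses (Mc : atlas c) (Gd : atlas d) (oU : open U).
Hypothesis spsi : forall p, U (pi p) -> smooth_at psi p.
Hypothesis schi : forall y g, U y -> smooth_at chi (y, g).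
Hypothesis chiK : forall p, U (pi p) -> chi (pi p, psi p) = p.
Hypothesis pi_chi :
  forall y g, U y -> pi (chi (y, g)) = y /\ psi (chi (y, g)) = g.

Let hc : is_chart c. Proof. by case: aM => + _ _; apply. Qed.
Let hd : is_chart d. Proof. by case: aG => + _ _; apply. Qed.

Definition fibre_chart_dom : set (M * E) :=
  [set y | [/\ cdom c y.1, U (pi y.2) & cdom d (psi y.2)]].

Definition fibre_chart_map (y : M * E) : 'rV[R]_(cdim c + cdim d) :=
  row_mx (cmap c y.1) (cmap d (psi y.2)).

Definition fibre_chart_inv (v : 'rV[R]_(cdim c + cdim d)) : M * E :=
  (cinv c (lsubmx v), chi (s (cinv c (lsubmx v)), cinv d (rsubmx v))).

Definition fibre_chart : chart R (set_type (fibre s pi)) :=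
  @Chart R (set_type (fibre s pi)) (cdim c + cdim d) (val @^-1` fibre_chart_dom)
    (fibre_chart_map \o val)
    (fun v => lift_fib x0 (fibre_chart_inv v).1 (fibre_chart_inv v).2).

Lemma fibre_chart_dom_open : open fibre_chart_dom.
Proof.
rewrite openE => -[m p] [/= cm Up dp].
have n1 : nbhs m (cdom c) := cdom_nbhs hc cm.
have n2 : nbhs p (pi @^-1` U).
  by apply: (smooth_at_continuous (pb_pi_smooth hE p)); apply: open_nbhs_nbhs.
have n3 : nbhs p (psi @^-1` (cdom d)).
  by apply: (smooth_at_continuous (spsi Up)); exact: cdom_nbhs.
exists (cdom c, pi @^-1` U `&` psi @^-1` (cdom d)) => /=.
  by split=> //; exact: filterI.
by move=> [m' p'] [/= cm' [Up' dp']].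
Qed.

Lemma fibre_chart_map_smooth y : fibre_chart_dom y -> smooth_at fibre_chart_map y.
Proof.
move=> [cy Uy dy]; have aME := prod_atlas aM aE.
apply: (@smooth_at_row_mx _ _ _ _ (cmap c \o fst) (cmap d \o (psi \o snd))).
  apply: smooth_at_comp => //; first exact: smooth_at_fst.
  exact: cmap_smooth.
apply: smooth_at_comp => //; last exact: cmap_smooth.
apply: smooth_at_comp => //; first exact: smooth_at_snd.
exact: spsi.
Qed.

Lemma fibre_chart_cimg v : cimg fibre_chart v <->
  [/\ cimg c (lsubmx v), U (s (cinv c (lsubmx v))) & cimg d (rsubmx v)].
Proof.
split=> [[x [cx Ux dx] <-]|[cv Uv dv]].
  rewrite /= /fibre_chart_map row_mxKl row_mxKr (cmapK hc) // fib_val.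
  by split=> //; [exists (val x).1|exists (psi (val x).2)].
have [pv psiv] := pi_chi (cinv d (rsubmx v)) Uv.
have vE : val (cinv fibre_chart v) = fibre_chart_inv v.
  by rewrite /= lift_fibE //= pv.
exists (cinv fibre_chart v).
  rewrite /= -/(cinv fibre_chart v) vE; split=> /=.
  - exact: (cinv_cdom hc).
  - by rewrite pv.
  - by rewrite psiv; exact: (cinv_cdom hd).
rewrite [LHS]/= -/(cinv fibre_chart v) vE /fibre_chart_map /= psiv.
by rewrite (cinvK hc) // (cinvK hd) // hsubmxK.
Qed.

Lemma fibre_chart_invE v : cimg fibre_chart v ->
  val (cinv fibre_chart v) = fibre_chart_inv v.
Proof.
move=> /fibre_chart_cimg [_ Uv _]; rewrite /= lift_fibE //=.
by have [-> _] := pi_chi (cinv d (rsubmx v)) Uv.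
Qed.

Lemma fibre_chart_inv_smooth v : cimg fibre_chart v ->
  smooth_at fibre_chart_inv v.
Proof.
move=> /fibre_chart_cimg [cv Uv dv].
have sl : smooth_at (cinv c \o lsubmx) v.
  apply: (@smooth_at_comp _ _ _ _ lsubmx (cinv c)); try exact: rV_atlas.
    by apply/smooth_at_rV; exact: Cinfty_at_lsubmx.
  exact: cinv_smooth.
have sr : smooth_at (cinv d \o rsubmx) v.
  apply: (@smooth_at_comp _ _ _ _ rsubmx (cinv d)); try exact: rV_atlas.
    by apply/smooth_at_rV; exact: Cinfty_at_rsubmx.
  exact: cinv_smooth.
apply: smooth_at_pair; first exact: sl.
apply: (@smooth_at_comp2 _ _ _ _ _ chi (s \o (cinv c \o lsubmx))
  (cinv d \o rsubmx));
  [exact: rV_atlas|exact: aN|exact: aG|exact: schi| |exact: sr].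
by apply: smooth_at_comp; [exact: rV_atlas|exact: aM|exact: sl|exact: ss].
Qed.

Lemma fibre_chart_cimg_open : open (cimg fibre_chart).
Proof.
rewrite openE => v /fibre_chart_cimg [cv Uv dv].
have cl : {for v, continuous (fun w : 'rV[R]_(cdim c + cdim d) => lsubmx w)}.
  exact: continuous_lsubmx.
have cr : {for v, continuous (fun w : 'rV[R]_(cdim c + cdim d) => rsubmx w)}.
  exact: continuous_rsubmx.
have n1 : nbhs v (lsubmx @^-1` (cimg c)).
  by apply: cl; apply: open_nbhs_nbhs; split=> //; case: hc.
have n2 : nbhs v (rsubmx @^-1` (cimg d)).
  by apply: cr; apply: open_nbhs_nbhs; split=> //; case: hd.
have n3 : nbhs v ((s \o (cinv c \o lsubmx)) @^-1` U).
  have cs : {for v, continuous (s \o (cinv c \o lsubmx))}.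
    apply: continuous_comp; last by case: (ss ((cinv c \o lsubmx) v)).
    apply: continuous_comp; first exact: cl.
    by case: hc => _ _ _ _; exact.
  by apply: cs; apply: open_nbhs_nbhs.
apply: filterS3 n1 n2 n3 => w w1 w2 w3.
by apply/fibre_chart_cimg.
Qed.

Lemma fibre_chart_val_inv_smooth v : cimg fibre_chart v ->
  smooth_at (val \o cinv fibre_chart) v.
Proof.
move=> fv; apply: smooth_at_eq (fibre_chart_inv_smooth fv).
  exact: rV_atlas.
have : nbhs v (cimg fibre_chart).
  by apply: open_nbhs_nbhs; split=> //; exact: fibre_chart_cimg_open.
by apply: filterS => w /fibre_chart_invE <-.
Qed.

Lemma fibre_chart_atlas : atlas fibre_chart.
Proof.
split; last exact: fibre_chart_val_inv_smooth.
- split.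
  + apply: open_comp fibre_chart_dom_open => y _.
    exact: sub_val_continuous.
  + exact: fibre_chart_cimg_open.
  + move=> x [cx Ux dx]; apply: lift_fib_val => /=;
      rewrite /fibre_chart_map row_mxKl ?row_mxKr (cmapK hc) //.
    by rewrite (cmapK hd) // fib_val chiK.
  + move=> x fx; apply: continuous_comp; first exact: sub_val_continuous.
    exact: (smooth_at_continuous (fibre_chart_map_smooth fx)).
  + move=> v /fibre_chart_val_inv_smooth /smooth_at_continuous.
    exact: sub_continuous.
- move=> x fx; exists fibre_chart_map, fibre_chart_dom; split=> //.
    exact: fibre_chart_dom_open.
  exact: fibre_chart_map_smooth.
Qed.

End Chart.

(** Over [U] the bundle is [U * G], so its pullback along [s] is
   [s @^-1` U * G], which has the charts of a product. *)
Lemma fibre_charts (x : set_type (fibre s pi)) :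
  exists2 c : chart R (set_type (fibre s pi)), atlas c & cdom c x.
Proof.
have [U [psi [chi [[oU Ux] [spsi schi] chiK pi_chi psi_act]]]] :=
  pb_locally_trivial hE (pi (val x).2).
have [_ /(_ (val x).1) [c Mc cx] _] := aM.
have [_ /(_ (psi (val x).2)) [d Gd dx] _] := aG.
exists (fibre_chart c d U psi chi x); last by [].
exact: fibre_chart_atlas.
Qed.

Lemma fibre_manifold : is_manifold (set_type (fibre s pi)).
Proof.
apply: sub_manifold; [exact: prod_atlas|exact: fibre_charts|].
by apply: prod_manifold => //; case: hE.
Qed.

End FibreProduct.

(** * Lie groups and Lie crossed modules *)

Section LieGroups.
Variables (R : realType) (M : premanifoldType R) (G : preLieGroupType R).
Hypotheses (hM : smooth_atlas M) (hG : is_lie_group G).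
Local Open Scope group_scope.

Lemma lie_group_atlas : smooth_atlas G.
Proof. by apply: manifold_atlas; case: hG. Qed.

Lemma smooth_at_mulg (f g : M -> G) x : smooth_at f x -> smooth_at g x ->
  smooth_at (fun y => f y * g y) x.
Proof.
move=> sf sg; have aG := lie_group_atlas.
apply: (@smooth_at_comp2 _ _ _ _ _ (fun y : G * G => y.1 * y.2) f g) => //.
by case: hG => _ + _; apply.
Qed.

Lemma smooth_at_invg (f : M -> G) x : smooth_at f x ->
  smooth_at (fun y => (f y)^-1) x.
Proof.
move=> sf; apply: (@smooth_at_comp _ _ _ _ f (fun y : G => y^-1)) => //.
  exact: lie_group_atlas.
by case: hG => _ _; apply.
Qed.

End LieGroups.

(** Used with the inversion of a groupoid, which exchanges source and target:
   being an involution, it is a diffeomorphism. *)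
Lemma submersion_involution (R : realType) (M N : premanifoldType R)
    (s t : M -> N) (i : M -> M) : smooth_atlas M -> smooth_atlas N ->
  involutive i -> smooth i -> submersion s -> (forall x, s (i x) = t x) ->
  submersion t.
Proof.
move=> hM hN iK si [ss us] sit.
have -> : t = s \o i by apply/funext => x; rewrite /= sit.
split=> x; first by apply: smooth_at_comp.
apply: submersive_comp => //; last exact: us.
by apply: (@submersive_section _ _ _ _ i) => //; exact: nearW.
Qed.

Section Projections.
Variables (R : realType) (M : premanifoldType R) (hM : smooth_atlas M).

Lemma smooth_at_fst_comp (N P : premanifoldType R) (f : M -> N * P) x :
  smooth_atlas N -> smooth_atlas P -> smooth_at f x ->
  smooth_at (fun y => (f y).1) x.
Proof.
move=> hN hP sf; apply: (@smooth_at_comp _ _ _ _ f (fun y : N * P => y.1)) => //.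
  exact: prod_atlas.
exact: smooth_at_fst.
Qed.

Lemma smooth_at_snd_comp (N P : premanifoldType R) (f : M -> N * P) x :
  smooth_atlas N -> smooth_atlas P -> smooth_at f x ->
  smooth_at (fun y => (f y).2) x.
Proof.
move=> hN hP sf; apply: (@smooth_at_comp _ _ _ _ f (fun y : N * P => y.2)) => //.
  exact: prod_atlas.
exact: smooth_at_snd.
Qed.

End Projections.

Section CrossedModules.
Variables (R : realType) (G H : preLieGroupType R) (cm : crossed_module G H).
Local Open Scope group_scope.

Lemma cm_tau1 : cm_tau cm 1 = 1.
Proof. by apply: (mulgI (cm_tau cm 1)); rewrite -cm_tau_hom !mulg1. Qed.

Lemma cm_tauV h : cm_tau cm h^-1 = (cm_tau cm h)^-1.
Proof.
by apply: (mulgI (cm_tau cm h)); rewrite -cm_tau_hom !mulgV cm_tau1.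
Qed.

Lemma cm_actV g h : cm_act cm g h^-1 = (cm_act cm g h)^-1.
Proof.
by apply: (mulgI (cm_act cm g h)); rewrite -cm_act_hom !mulgV sd_act1r.
Qed.

Lemma cm_actK g h : cm_act cm g^-1 (cm_act cm g h) = h.
Proof. by rewrite -cm_actM mulVg cm_act1. Qed.

Lemma cm_actVK g h : cm_act cm g (cm_act cm g^-1 h) = h.
Proof. by rewrite -cm_actM mulgV cm_act1. Qed.

Hypothesis hcm : is_lie_crossed_module cm.

Let hG : is_lie_group G. Proof. by case: hcm. Qed.
Let hH : is_lie_group H. Proof. by case: hcm. Qed.
Let aG : smooth_atlas G := lie_group_atlas hG.
Let aH : smooth_atlas H := lie_group_atlas hH.

Section Maps.
Variables (M : premanifoldType R) (hM : smooth_atlas M).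

Lemma smooth_at_cm_act (f : M -> G) (g : M -> H) x :
  smooth_at f x -> smooth_at g x -> smooth_at (fun y => cm_act cm (f y) (g y)) x.
Proof.
move=> sf sg; apply: (@smooth_at_comp2 _ _ _ _ _
  (fun y : G * H => cm_act cm y.1 y.2) f g) => //.
by case: hcm => _ _ + _; apply.
Qed.

Lemma smooth_at_cm_tau (f : M -> H) x :
  smooth_at f x -> smooth_at (fun y => cm_tau cm (f y)) x.
Proof.
move=> sf; apply: (@smooth_at_comp _ _ _ _ f (cm_tau cm)) => //.
by case: hcm => _ _ _; apply.
Qed.

End Maps.

Lemma sdprod_lie_group : is_lie_group (sdprod cm).
Proof.
have aS : smooth_atlas (H * G)%type by exact: prod_atlas.
have aSS : smooth_atlas ((H * G) * (H * G))%type by exact: prod_atlas.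
split.
- by apply: (@prod_manifold R H G); [case: hH|case: hG].
- move=> x; apply: (@smooth_at_pair R _ H G).
    apply: smooth_at_mulg => //.
      by do 2!apply: smooth_at_fst_comp => //; exact: smooth_at_id.
    apply: smooth_at_cm_act => //.
      apply: smooth_at_snd_comp => //; apply: smooth_at_fst_comp => //.
      exact: smooth_at_id.
    apply: smooth_at_fst_comp => //; apply: smooth_at_snd_comp => //.
    exact: smooth_at_id.
  apply: smooth_at_mulg => //.
    apply: smooth_at_snd_comp => //; apply: smooth_at_fst_comp => //.
    exact: smooth_at_id.
  by do 2!apply: smooth_at_snd_comp => //; exact: smooth_at_id.
- have s1 (x : H * G) : smooth_at (fun y : H * G => y.1) x.
    exact: smooth_at_fst.
  have s2 (x : H * G) : smooth_at (fun y : H * G => y.2) x.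
    exact: smooth_at_snd.
  move=> x; apply: (@smooth_at_pair R _ H G).
    by apply: smooth_at_cm_act => //; apply: smooth_at_invg.
  by apply: smooth_at_invg.
Qed.

Let aS : smooth_atlas (sdprod cm).
Proof. exact: lie_group_atlas sdprod_lie_group. Qed.

Lemma cm_src_submersion : submersion (@cm_src R G H cm).
Proof.
have ss : smooth (@cm_src R G H cm).
  by move=> x; exact: (@smooth_at_snd R H G).
split=> // -[h g].
apply: (@submersive_section _ _ _ _ (fun g' => (h, g') : sdprod cm)) => //.
  by apply: (@smooth_at_pair R G H G); [exact: smooth_at_cst|exact: smooth_at_id].
exact: nearW.
Qed.

Definition cm_ginv (x : sdprod cm) : sdprod cm := (x.1^-1, cm_tau cm x.1 * x.2).

Lemma cm_ginv_smooth : smooth cm_ginv.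
Proof.
move=> x; have s1 : smooth_at (fun y : H * G => y.1) x by exact: smooth_at_fst.
have s2 : smooth_at (fun y : H * G => y.2) x by exact: smooth_at_snd.
apply: (@smooth_at_pair R _ H G); first exact: smooth_at_invg.
by apply: smooth_at_mulg => //; exact: smooth_at_cm_tau.
Qed.

Lemma cm_ginvK : involutive cm_ginv.
Proof. by move=> [h g]; rewrite /cm_ginv /= invgK cm_tauV mulKg. Qed.

Lemma cm_tgt_submersion : submersion (@cm_tgt R G H cm).
Proof.
apply: (@submersion_involution _ _ _ _ _ cm_ginv) => //.
- exact: cm_ginvK.
- exact: cm_ginv_smooth.
- exact: cm_src_submersion.
- by [].
Qed.

Lemma cm_comp_smooth : smooth_sub (@tg_comp R (cm_two_group cm)).
Proof.
move=> x; exists (fun y : sdprod cm * sdprod cm => (y.1.1 * y.2.1, y.2.2)), setT.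
split=> //; first exact: openT.
move=> y _; have aSS := @prod_atlas R H G aH aG.
have aSS2 := @prod_atlas R _ _ aSS aSS.
apply: (@smooth_at_pair R ((H * G) * (H * G))%type H G).
  apply: smooth_at_mulg => //.
    by do 2!apply: smooth_at_fst_comp => //; exact: smooth_at_id.
  apply: smooth_at_fst_comp => //; apply: smooth_at_snd_comp => //.
  exact: smooth_at_id.
by do 2!apply: smooth_at_snd_comp => //; exact: smooth_at_id.
Qed.

Lemma cm_lie_groupoid : is_lie_groupoid (cm_two_group cm).
Proof.
split=> //=.
- by case: hG.
- by case: sdprod_lie_group.
- exact: cm_src_submersion.
- by move=> g; exists (1, g).
- exact: cm_tgt_submersion.
- by move=> g; exists (1, g); rewrite /cm_tgt /= cm_tau1 mul1g.
- exact: cm_comp_smooth.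
- by move=> g; apply: (@smooth_at_pair R G H G);
    [exact: smooth_at_cst|exact: smooth_at_id].
- exact: cm_ginv_smooth.
- by move=> g; rewrite /cm_tgt /= cm_tau1 mul1g.
- by move=> [h2 g2] [h1 g1] /= e; rewrite /cm_tgt /= cm_tau_hom -mulgA; congr (_ * _).
- by move=> [h3 g3] [h2 g2] [h1 g1] /= *; rewrite mulgA.
- by move=> [h g] e /=; rewrite mulg1.
- by move=> [h g] e /=; rewrite mul1g.
- by move=> [h g]; rewrite /cm_tgt /= cm_tauV mulKg.
- by move=> [h g] e /=; rewrite mulgV.
- by move=> [h g] e /=; rewrite mulVg.
Qed.

Lemma cm_lie_2group : is_lie_2group (cm_two_group cm).
Proof.
split=> //=.
- exact: cm_lie_groupoid.
- exact: sdprod_lie_group.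
- by move=> [h g] [h' g']; rewrite /cm_tgt /= cm_tau_hom cm_tau_act !mulgA mulgVK.
- move=> [h2 g2] [h1 g1] [k2 l2] [k1 l1] /= + + _; rewrite /cm_src /cm_tgt /=.
  move=> -> _; congr (_, _).
  by rewrite cm_actM cm_act_tau !mulgA mulgVK cm_act_hom !mulgA.
- by move=> g g'; congr (_, _); rewrite /= sd_act1r mulg1.
- move=> [h g] [h' g']; congr (_, _) => /=.
  + by rewrite invgM cm_actM cm_act_tau cm_actV !mulgA mulVg mul1g.
  + by rewrite cm_tau_hom cm_tau_act !mulgA mulgVK.
Qed.

End CrossedModules.

(** * The decorated groupoid *)

Lemma fib_congr (A B C : Type) (f : A -> C) (g : B -> C) a a' b b'
    (e : f a = g b) (e' : f a' = g b') : a = a' -> b = b' -> fib e = fib e'.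
Proof. by move=> ? ?; subst; congr fib; exact: Prop_irrelevance. Qed.

(** Associate [ginv (ginv f)], [ginv f] and [f] in the two possible ways. *)
Lemma lie_groupoid_ginvK (R : realType) (X : groupoid R) :
  is_lie_groupoid X -> involutive (@ginv R X).
Proof.
move=> hX f.
have e21 : src (ginv f) = tgt f := src_ginv hX f.
have e32 : src (ginv (ginv f)) = tgt (ginv f) := src_ginv hX (ginv f).
have e3 : src (ginv (ginv f)) = tgt (gcomp (fib e21)).
  by rewrite (tgt_comp hX) e32.
have e1 : src (gcomp (fib e32)) = tgt f by rewrite (src_comp hX) e21.
have := Defs.compA hX e3 e1.
have uf : tgt (gunit (src f)) = src f := tgt_unit hX _.
have e4 : src (ginv (ginv f)) = tgt (gunit (src (ginv (ginv f)))).
  by rewrite (tgt_unit hX).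
rewrite (_ : fib e3 = fib e4); last first.
  apply: fib_congr => //.
  by rewrite (comp_ginvl hX) (src_ginv hX) (tgt_ginv hX).
have e5 : src (gunit (tgt f)) = tgt f := src_unit hX _.
rewrite (_ : fib e1 = fib e5); last first.
  by apply: fib_congr => //; rewrite (comp_ginvl hX) (src_ginv hX).
by rewrite (comp_unitr hX) (comp_unitl hX).
Qed.

Section DecoratedGroupoid.
Variables (R : realType) (G H : preLieGroupType R) (cm : crossed_module G H).
Variables (X : groupoid R) (E : premanifoldType R) (pi : E -> ob X).
Variables (act : E * G -> E) (mu : set_type (fibre (@src R X) pi) -> E).
Hypothesis hE : is_principal_groupoid_bundle act mu.
Hypothesis hcm : is_lie_crossed_module cm.
Local Open Scope group_scope.

Local Notation sE := (set_type (fibre (@src R X) pi)).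
Local Notation dec := (dec H pi).
Local Notation dec_tgt := (@dec_tgt R G H cm X E pi act mu).
Local Notation dec_src := (@dec_src R H X E pi).
Local Notation dec_inv := (@dec_inv R G H cm X E pi act mu hE).

Let hX : is_lie_groupoid X := pgb_groupoid hE.
Let hB : is_principal_bundle pi act := pgb_bundle hE.
Let hG : is_lie_group G. Proof. by case: hcm. Qed.
Let hH : is_lie_group H. Proof. by case: hcm. Qed.
Let aG : smooth_atlas G := lie_group_atlas hG.
Let aH : smooth_atlas H := lie_group_atlas hH.
Let mE : is_manifold E := pb_total hB.
Let aE : smooth_atlas E := manifold_atlas mE.
Let aX0 : smooth_atlas (ob X) := manifold_atlas (ob_manifold hX).
Let aX1 : smooth_atlas (ar X) := manifold_atlas (ar_manifold hX).
Let ssrc : smooth (@src R X). Proof. by case: (src_submersion hX). Qed.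
Let aXE : smooth_atlas (ar X * E)%type := prod_atlas aX1 aE.
Let chartsE : forall x : sE, exists2 c : chart R sE, atlas c & cdom c x :=
  fibre_charts (ar_manifold hX) hB ssrc.
Let aF : smooth_atlas sE := sub_atlas_smooth aXE chartsE.

Lemma dec_manifold : is_manifold dec.
Proof.
apply: (@prod_manifold R sE H); last by case: hH.
exact: fibre_manifold (ar_manifold hX) hB ssrc.
Qed.

Let aD : smooth_atlas dec := manifold_atlas dec_manifold.

Lemma dec_eq (x y : dec) : dec_arrow x = dec_arrow y ->
  dec_point x = dec_point y -> x.2 = y.2 -> x = y.
Proof.
case: x y => [x h] [y k] /= xy1 xy2 ->; congr (_, _); apply: val_inj.
by move: xy1 xy2; rewrite /dec_arrow /dec_point /=; case: (val x) (val y)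
  => [? ?] [? ?] /= -> ->.
Qed.

Lemma act_mulg p g g' : act (act (p, g), g') = act (p, g * g').
Proof. by rewrite (pb_actM hB). Qed.

Lemma act_id p : act (p, 1) = p.
Proof. exact: pb_act1 hB p. Qed.

Section Smoothness.
Variables (M : premanifoldType R) (hM : smooth_atlas M).

Lemma smooth_at_act (f : M -> E) (g : M -> G) x :
  smooth_at f x -> smooth_at g x -> smooth_at (fun y => act (f y, g y)) x.
Proof.
move=> sf sg; apply: (@smooth_at_comp2 _ _ _ _ _ act f g) => //.
exact: pb_act_smooth hB _.
Qed.

Lemma smooth_at_mu (f : M -> sE) x : smooth_at f x ->
  smooth_at (fun y => mu (f y)) x.
Proof.
move=> sf; apply: (@smooth_at_comp _ _ _ _ f mu) => //.
exact: (smooth_sub_smooth aXE chartsE (pgb_mu_smooth hE)).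
Qed.

(** The pullback of [E] carries the smooth structure induced from [ar X * E], so
   the three components can be treated separately. *)
Lemma smooth_at_into_dec (f : M -> dec) x :
  smooth_at (fun y => dec_arrow (f y)) x ->
  smooth_at (fun y => dec_point (f y)) x ->
  smooth_at (fun y => (f y).2) x -> smooth_at f x.
Proof.
move=> s1 s2 s3.
have -> : f = fun y => ((f y).1, (f y).2) by apply/funext => y; case: (f y).
apply: (@smooth_at_pair R M sE H) => //; apply: smooth_at_sub => //.
have -> : val \o (fun y => (f y).1) =
    fun y => (dec_arrow (f y), dec_point (f y)).
  by apply/funext => y; rewrite /dec_arrow /dec_point /=; case: (val (f y).1).
exact: smooth_at_pair.
Qed.

Lemma smooth_at_dec1 (f : M -> dec) x : smooth_at f x ->
  smooth_at (fun y => (f y).1) x.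
Proof. by move=> sf; apply: (@smooth_at_fst_comp R M hM sE H). Qed.

Lemma smooth_at_decoration (f : M -> dec) x : smooth_at f x ->
  smooth_at (fun y => (f y).2) x.
Proof. by move=> sf; apply: (@smooth_at_snd_comp R M hM sE H). Qed.

Lemma smooth_at_dec_val (f : M -> dec) x : smooth_at f x ->
  smooth_at (fun y => val (f y).1) x.
Proof.
move=> sf; apply: (@smooth_at_comp R M sE _ (fun y => (f y).1) val) => //.
  exact: smooth_at_dec1.
exact: smooth_at_val.
Qed.

Lemma smooth_at_dec_arrow (f : M -> dec) x : smooth_at f x ->
  smooth_at (fun y => dec_arrow (f y)) x.
Proof.
by move=> sf; apply: smooth_at_fst_comp => //; exact: smooth_at_dec_val.
Qed.

Lemma smooth_at_dec_point (f : M -> dec) x : smooth_at f x ->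
  smooth_at (fun y => dec_point (f y)) x.
Proof.
by move=> sf; apply: smooth_at_snd_comp => //; exact: smooth_at_dec_val.
Qed.

Lemma smooth_at_dec_tgt (f : M -> dec) x : smooth_at f x ->
  smooth_at (fun y => dec_tgt (f y)) x.
Proof.
move=> sf; apply: smooth_at_act; first exact/smooth_at_mu/smooth_at_dec1.
by apply: smooth_at_cm_tau => //; apply: smooth_at_invg => //;
  exact: smooth_at_decoration.
Qed.

End Smoothness.

Lemma dec_unit_smooth : smooth (dec_unit H hE).
Proof.
move=> p; apply: smooth_at_into_dec => //=.
- apply: (@smooth_at_comp _ _ _ _ pi (@gunit R X)) => //.
    exact: pb_pi_smooth hB p.
  exact: unit_smooth hX _.
- exact: smooth_at_id.
- exact: smooth_at_cst.
Qed.

Lemma dec_inv_smooth : smooth dec_inv.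
Proof.
move=> x; have sx := smooth_at_id x aD; apply: smooth_at_into_dec => //=.
- apply: (@smooth_at_comp _ _ _ _ (@dec_arrow _ _ _ _ _) (@ginv R X)) => //.
    exact: smooth_at_dec_arrow sx.
  exact: ginv_smooth hX _.
- exact: smooth_at_dec_tgt.
- by apply: smooth_at_invg => //; exact: smooth_at_decoration sx.
Qed.

(** In the parametrisation [par] of the arrows with decoration [x0.2], the source
   becomes [chi \o m], where [m] is the product of the source map of [X] with the
   identity and [chi] has the local section [(pi, psi)]. *)
Lemma dec_src_submersion : submersion dec_src.
Proof.
have ss : smooth dec_src.
  move=> x; apply: (@smooth_at_dec_point _ aD id).
  exact: smooth_at_id.
split=> // x0; pose g0 := dec_arrow x0; pose p0 := dec_point x0.
have [U [psi [chi [[oU Up] [spsi schi] chiK pi_chi _]]]] :=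
  pb_locally_trivial hB (pi p0).
pose P := (ar X * G)%type.
have aP : smooth_atlas P by exact: prod_atlas.
pose w : P := (g0, psi p0).
have g0p0 : src g0 = pi p0 := dec_arrowP x0.
have Ug0 : U (src g0) by rewrite g0p0.
pose m (y : P) := (src y.1, y.2) : ob X * G.
have sm (y : P) : smooth_at m y.
  apply: (@smooth_at_pair R P (ob X) G).
    apply: (@smooth_at_comp R P (ar X) _ (fun y => y.1)) => //.
    exact: smooth_at_fst.
  exact: smooth_at_snd.
have nU : \forall y \near w, U (src y.1).
  have : nbhs w ((fun y : P => src y.1) @^-1` U).
    have : {for w, continuous (fun y : P => src y.1)}.
      apply: (@continuous_comp _ _ _ (fun y : P => y.1)); first exact: cvg_fst.
      exact: smooth_at_continuous (ssrc _).
    by apply; apply: open_nbhs_nbhs.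
  exact.
have scm : smooth_at (chi \o m) w.
  by apply: smooth_at_comp => //; [exact: prod_atlas|exact: schi].
pose par (y : P) : dec := (lift_fib x0.1 y.1 (chi (m y)), x0.2).
have parE (y : P) : U (src y.1) -> val (par y).1 = (y.1, chi (m y)).
  by move=> Uy; rewrite lift_fibE // (pi_chi _ y.2 Uy).1.
have parw : par w = x0.
  have cw : chi (m w) = p0 by rewrite /m /= g0p0 chiK.
  by apply: dec_eq; rewrite // ?/dec_arrow ?/dec_point parE //= cw.
have spar : smooth_at par w.
  apply: smooth_at_into_dec => //; last exact: smooth_at_cst.
    apply: (@smooth_at_eq _ _ _ (fun y : P => y.1)) => //.
      by apply: filterS nU => y Uy; rewrite /dec_arrow parE.
    exact: smooth_at_fst.
  apply: smooth_at_eq scm => //.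
  by apply: filterS nU => y Uy; rewrite /dec_point parE.
rewrite -parw; apply: submersive_cancel => //.
apply: (@submersive_eq _ _ _ (chi \o m)) => //.
  by apply: filterS nU => y Uy; rewrite /= /Defs.dec_src /dec_point parE.
apply: submersive_comp => //; [exact: prod_atlas|exact: schi| |].
  apply: (@submersive_prod _ _ _ _ _ (@src R X) id) => //.
  - exact: smooth_at_id.
  - by case: (src_submersion hX) => _; apply.
  - exact: submersive_id.
have p0E : chi (m w) = p0 by rewrite /m /= g0p0 chiK.
apply: (@submersive_section _ _ _ _ (fun p => (pi p, psi p))) => //.
- exact: prod_atlas.
- exact: schi.
- rewrite p0E; apply: smooth_at_pair; last exact: spsi.
  exact: pb_pi_smooth hB _.
- by rewrite p0E /m /w /= g0p0.
- rewrite p0E; have : nbhs p0 (pi @^-1` U).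
    apply: (smooth_at_continuous (pb_pi_smooth hB p0)).
    exact: open_nbhs_nbhs.
  by apply: filterS => p Upp; rewrite chiK.
Qed.

Lemma mu_congr f f' p p' (e : src f = pi p) (e' : src f' = pi p') :
  f = f' -> p = p' -> mu (fib e) = mu (fib e').
Proof. by move=> ff' pp'; congr mu; exact: fib_congr. Qed.

(** The factors [tau h^-1] and [tau h] cancel because [mu] commutes with the
   action, and then [mu] is applied to a unit. *)
Lemma dec_tgt_inv x : dec_tgt (dec_inv x) = dec_point x.
Proof.
have e : src (gcomp (fib (src_ginv hX (dec_arrow x)))) = pi (dec_point x).
  by rewrite (src_comp hX) dec_arrowP.
have e2 : src (ginv (dec_arrow x)) = pi (mu (fib (dec_arrowP x))).
  by rewrite (src_ginv hX) (pgb_pi_mu hE).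
have eu : src (gunit (pi (dec_point x))) = pi (dec_point x).
  exact: src_unit hX _.
have e2' : src (ginv (dec_arrow x)) =
    pi (act (mu (fib (dec_arrowP x)), cm_tau cm x.2^-1)).
  by rewrite (pb_pi_act hB).
rewrite /Defs.dec_tgt /= invgK.
rewrite (_ : mu (fib (dec_invP cm hE x)) = mu (fib e2')); last first.
  by apply: mu_congr; rewrite // fib_arrow_point.
rewrite -(pgb_mu_act hE e2 e2') act_mulg -cm_tau_hom mulVg cm_tau1 act_id.
rewrite -(pgb_mu_comp hE e e2) -[RHS](pgb_mu_unit hE eu).
by apply: mu_congr => //; rewrite (comp_ginvl hX) dec_arrowP.
Qed.

Lemma dec_invK : involutive dec_inv.
Proof.
move=> x; apply: dec_eq => /=.
- exact: lie_groupoid_ginvK hX _.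
- exact: dec_tgt_inv.
- exact: invgK.
Qed.

Lemma dec_tgt_submersion : submersion dec_tgt.
Proof.
apply: (submersion_involution aD aE dec_invK dec_inv_smooth dec_src_submersion).
by [].
Qed.

(** The composition of [X] extends to a smooth map [F] near a composable pair,
   but the source of the extended composite need not be the projection of the
   point of the first arrow. That point is replaced by the one with the same
   fibre coordinate [psi] over the new source, which does not change it on
   composable pairs. *)
Lemma dec_comp_smooth : smooth_sub (@dec_comp R G H cm X E pi act mu hE).
Proof.
move=> x; pose x2 := (val x).1; pose x1 := (val x).2; pose y0 := val x.
pose p1 := dec_point x1.
pose c0 := fib (dec_composable (cm := cm) hE x).
have [F [W [oW Wc sF FE]]] := comp_smooth hX c0.
have [U [psi [chi [[oU Up] [spsi schi] chiK pi_chi _]]]] :=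
  pb_locally_trivial hB (pi p1).
pose D := (dec * dec)%type.
have aDD : smooth_atlas D by exact: prod_atlas.
pose arr (y : D) := (dec_arrow y.1, dec_arrow y.2).
pose A (y : D) := F (arr y).
pose q (y : D) := chi (src (A y), psi (dec_point y.2)).
pose V := [set y : D | [/\ W (arr y), U (src (A y)) & U (pi (dec_point y.2))]].
have sx1 (y : D) : smooth_at (fun z : D => z.1) y by exact: smooth_at_fst.
have sx2 (y : D) : smooth_at (fun z : D => z.2) y by exact: smooth_at_snd.
have sarr y : smooth_at arr y.
  by apply: smooth_at_pair; apply: smooth_at_dec_arrow.
have sA y : W (arr y) -> smooth_at A y.
  move=> Wy; apply: smooth_at_comp => //; [exact: prod_atlas|exact: sF].
have ssA y : W (arr y) -> smooth_at (fun y => src (A y)) y.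
  by move=> /sA sAy; apply: (@smooth_at_comp _ _ _ _ A (@src R X)).
have sp2 (y : D) : smooth_at (fun z : D => dec_point z.2) y.
  exact: smooth_at_dec_point.
have spp2 (y : D) : smooth_at (fun z : D => pi (dec_point z.2)) y.
  apply: (@smooth_at_comp _ _ _ _ (fun z : D => dec_point z.2) pi) => //.
  exact: pb_pi_smooth hB _.
have sq y : V y -> smooth_at q y.
  move=> [Wy Uy Uy2]; apply: (@smooth_at_comp2 R D (ob X) G E chi
    (fun y => src (A y)) (fun y => psi (dec_point y.2))) => //.
  - exact: schi.
  - exact: ssA.
  - apply: (@smooth_at_comp _ _ _ _ (fun z : D => dec_point z.2) psi) => //.
    exact: spsi.
have oV : open V.
  rewrite openE => y [Wy Uy Uy2].
  have n1 : nbhs y (arr @^-1` W).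
    by apply: (smooth_at_continuous (sarr y)); apply: open_nbhs_nbhs.
  have n2 : nbhs y ((fun y => src (A y)) @^-1` U).
    by apply: (smooth_at_continuous (ssA y Wy)); apply: open_nbhs_nbhs.
  have n3 : nbhs y ((fun y : D => pi (dec_point y.2)) @^-1` U).
    by apply: (smooth_at_continuous (spp2 y)); apply: open_nbhs_nbhs.
  by apply: filterS3 n1 n2 n3 => z.
pose ext (y : D) : dec := (lift_fib x1.1 (A y) (q y), y.1.2 * y.2.2).
have extE y : V y -> val (ext y).1 = (A y, q y).
  by move=> [_ Uy _]; rewrite lift_fibE // (pi_chi _ (psi (dec_point y.2)) Uy).1.
have nV y : V y -> \forall z \near y, val (ext z).1 = (A z, q z).
  move=> Vy; have : nbhs y V by apply: open_nbhs_nbhs.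
  by apply: filterS => z; exact: extE.
exists ext, V; split=> //.
- split=> //; first by rewrite /= /A (FE c0 Wc) (src_comp hX) dec_arrowP.
- move=> y Vy; apply: smooth_at_into_dec => //.
  + case: (Vy) => Wy _ _; apply: smooth_at_eq (sA y Wy) => //.
    by apply: filterS (nV y Vy) => z zE; rewrite /dec_arrow zE.
  + apply: smooth_at_eq (sq y Vy) => //.
    by apply: filterS (nV y Vy) => z zE; rewrite /dec_point zE.
  + by apply: smooth_at_mulg => //; apply: smooth_at_decoration.
- move=> y Vy; case: (Vy) => Wy _ Uy2.
  have AE : A (val y) = gcomp (fib (dec_composable (cm := cm) hE y)).
    exact: (FE (fib (dec_composable (cm := cm) hE y)) Wy).
  apply: dec_eq => //; first by rewrite {1}/dec_arrow extE.
  rewrite {1}/dec_point extE //= /q AE (src_comp hX) dec_arrowP chiK //.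
Qed.

(** Since [mu] commutes with the action, [tau h1^-1] can be pulled out of the
   outer [mu], where it meets [tau h2^-1]; their product is
   [tau (h2 * h1)^-1]. *)
Lemma dec_comp_tgt x2 x1 (e : dec_src x2 = dec_tgt x1) :
  dec_tgt (dec_comp hE (fib e)) = dec_tgt x2.
Proof.
set c := dec_comp hE (fib e).
have e12 : src (dec_arrow x2) = tgt (dec_arrow x1).
  exact: (dec_composable hE (fib e)).
have ec : src (gcomp (fib e12)) = pi (dec_point x1).
  by rewrite (src_comp hX) dec_arrowP.
have e2 : src (dec_arrow x2) = pi (mu (fib (dec_arrowP x1))).
  by rewrite (pgb_pi_mu hE).
have e2' : src (dec_arrow x2) =
    pi (act (mu (fib (dec_arrowP x1)), cm_tau cm x1.2^-1)).
  by rewrite (pb_pi_act hB).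
have muc : mu c.1 = mu (fib e2).
  by rewrite -(pgb_mu_comp hE ec e2); apply: mu_congr => //; congr gcomp;
    exact: fib_congr.
have mu2 : mu x2.1 = act (mu (fib e2), cm_tau cm x1.2^-1).
  rewrite (pgb_mu_act hE e2 e2') -fib_arrow_point; apply: mu_congr => //.
  by rewrite fib_arrow_point.
by rewrite /Defs.dec_tgt muc mu2 act_mulg -cm_tau_hom /= invgM.
Qed.

Lemma dec_tgt_unit p : dec_tgt (dec_unit H hE p) = p.
Proof.
by rewrite /Defs.dec_tgt /= (pgb_mu_unit hE) invg1 cm_tau1 act_id.
Qed.

Lemma dec_lie_groupoid : is_lie_groupoid (dec_groupoid cm hE).
Proof.
split=> /=.
- exact: mE.
- exact: dec_manifold.
- exact: dec_src_submersion.
- by move=> p; exists (dec_unit H hE p).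
- exact: dec_tgt_submersion.
- by move=> p; exists (dec_unit H hE p); exact: dec_tgt_unit.
- exact: dec_comp_smooth.
- exact: dec_unit_smooth.
- exact: dec_inv_smooth.
- by [].
- exact: dec_tgt_unit.
- by [].
- exact: dec_comp_tgt.
- move=> x3 x2 x1 e32 e21 e3 e1; apply: dec_eq => //=; last exact: mulgA.
  exact: (Defs.compA hX (dec_composable hE (fib e3))
    (dec_composable hE (fib e1))).
- move=> x e; apply: dec_eq => //=; last exact: mulg1.
  have e' : src (dec_arrow x) = tgt (gunit (src (dec_arrow x))).
    by rewrite (tgt_unit hX).
  rewrite -[RHS](comp_unitr hX e'); congr gcomp; apply: fib_congr => //=.
  by rewrite dec_arrowP.
- move=> x e; apply: dec_eq => //=; last exact: mul1g.
  have e' : src (gunit (tgt (dec_arrow x))) = tgt (dec_arrow x).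
    by rewrite (src_unit hX).
  rewrite -[RHS](comp_unitl hX e'); congr gcomp; apply: fib_congr => //=.
  by rewrite -(pi_dec_tgt cm hE).
- by [].
- exact: dec_tgt_inv.
- move=> x e; apply: dec_eq => //=; last exact: mulgV.
  exact: etrans (comp_ginvr hX (dec_composable hE (fib e)))
    (congr1 _ (esym (pi_dec_tgt cm hE x))).
- move=> x e; apply: dec_eq => //=; last exact: mulVg.
  exact: etrans (comp_ginvl hX (dec_composable hE (fib e)))
    (congr1 _ (dec_arrowP x)).
Qed.

(** * The decorated groupoid as a principal 2-bundle *)

Local Notation dec_rho := (@dec_rho R G H cm X E pi act mu hE).
Local Notation dec_groupoid := (dec_groupoid cm hE).

Lemma dec_arrow_smooth : smooth (@dec_arrow R H X E pi).
Proof.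
move=> x; apply: (@smooth_at_dec_arrow _ aD id); exact: smooth_at_id.
Qed.

Lemma dec_projection_functor :
  @is_lie_functor R dec_groupoid X pi (@dec_arrow R H X E pi).
Proof.
split=> //=.
- exact: pb_pi_smooth hB.
- exact: dec_arrow_smooth.
- by move=> x; exact: dec_arrowP.
- by move=> x; rewrite -(pi_dec_tgt cm hE).
- by move=> x2 x1 e e'; congr gcomp; exact: fib_congr.
Qed.

Let aS : smooth_atlas (sdprod cm).
Proof. exact: lie_group_atlas (sdprod_lie_group hcm). Qed.

Let aDS : smooth_atlas (dec * sdprod cm)%type := prod_atlas aD aS.

Lemma dec_rho_smooth : smooth dec_rho.
Proof.
move=> y.
have s1 : smooth_at (fun z : dec * sdprod cm => z.1) y by exact: smooth_at_fst.
have s2 : smooth_at (fun z : dec * sdprod cm => z.2) y by exact: smooth_at_snd.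
have sh : smooth_at (fun z : dec * sdprod cm => z.2.1 : H) y.
  exact: (@smooth_at_fst_comp R _ aDS H G).
have sg : smooth_at (fun z : dec * sdprod cm => z.2.2 : G) y.
  exact: (@smooth_at_snd_comp R _ aDS H G).
apply: smooth_at_into_dec => //=.
- exact: smooth_at_dec_arrow s1.
- by apply: smooth_at_act => //; exact: smooth_at_dec_point s1.
- apply: smooth_at_cm_act => //; first exact: smooth_at_invg.
  apply: smooth_at_mulg => //; first exact: smooth_at_invg.
  exact: smooth_at_decoration s1.
Qed.

(** Let [k = (h, g)]. By equivariance, [tau] sends the inverse of the new
   decoration to [g^-1 * tau (x.2^-1 * h) * g], whose first factor cancels the
   [g] that moved the point. *)
Lemma dec_tgt_rho x (k : sdprod cm) :
  dec_tgt (dec_rho (x, k)) = act (dec_tgt x, cm_tgt k).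
Proof.
case: k => h g; rewrite /Defs.dec_tgt /cm_tgt /=.
rewrite -(pgb_mu_act hE (dec_arrowP x)) fib_arrow_point !act_mulg.
congr (act (_, _)); rewrite -cm_actV cm_tau_act invgM invgK !cm_tau_hom.
by rewrite invgK !mulgA mulgV mul1g.
Qed.

Lemma dec_action_functor :
  @is_lie_functor R (prod_groupoid dec_groupoid (cm_two_group cm)) dec_groupoid
    act dec_rho.
Proof.
split=> //=.
- exact: pb_act_smooth hB.
- exact: dec_rho_smooth.
- by move=> [x k]; rewrite dec_tgt_rho.
- move=> [x2 [h2 g2]] [x1 [h1 g1]] e e'; apply: dec_eq => //=.
    by congr gcomp; exact: fib_congr.
  (* Composability in the 2-group; the Peiffer identity then turns the action of
     [g2^-1] into that of [g1^-1] after a conjugation by [h1]. *)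
  have g2E : g2 = cm_tau cm h1 * g1 by have [] := e.
  rewrite g2E (invgM (cm_tau cm h1)) cm_actM -cm_tauV cm_act_tau invgK.
  by rewrite -cm_act_hom invgM !mulgA mulgK.
- move=> [p g]; apply: dec_eq => //=.
    by rewrite /dec_arrow /= (pb_pi_act hB).
  by rewrite invg1 mulg1 sd_act1r.
Qed.

(** Over [src @^-1` U] the bundle of arrows has the section
   [gamma |-> (gamma, chi (src gamma, 1), 1)]. Moving it by [(h, g)] gives
   [(gamma, chi (src gamma, g), cm_act cm g^-1 h^-1)], which is [chi1]; solving
   for [(h, g)] gives [psi1]. *)
Lemma dec_arrow_bundle :
  @is_principal_bundle R (sdprod cm) dec (ar X) (@dec_arrow R H X E pi) dec_rho.
Proof.
split.
- exact: sdprod_lie_group.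
- exact: dec_manifold.
- exact: ar_manifold.
- exact: dec_arrow_smooth.
- exact: dec_rho_smooth.
- move=> x; apply: dec_eq => //=; first exact: act_id.
  by rewrite !invg1 mul1g cm_act1.
- move=> x [h g] [h' g']; apply: dec_eq => //=.
    by rewrite /dec_point /= act_mulg.
  rewrite !invgM cm_actM; congr cm_act; rewrite -cm_actV !cm_act_hom.
  by rewrite cm_actK mulgA.
- by [].
- move=> f0; have [U [psi [chi [[oU Uf] [spsi schi] chiK pi_chi psi_act]]]] :=
    pb_locally_trivial hB (src f0).
  (* [chi1] takes junk values built from [x0] outside [src @^-1` U]. *)
  pose x0 : sE := fib (esym (pi_chi _ 1 Uf).1).
  pose psi1 (x : dec) : sdprod cm :=
    (cm_act cm (psi (dec_point x)) x.2^-1, psi (dec_point x)).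
  pose chi1 (y : ar X * sdprod cm) : dec :=
    (lift_fib x0 y.1 (chi (src y.1, y.2.2)), cm_act cm y.2.2^-1 y.2.1^-1).
  have chi1E y : U (src y.1) -> val (chi1 y).1 = (y.1, chi (src y.1, y.2.2)).
    by move=> Uy; rewrite lift_fibE // (pi_chi _ y.2.2 Uy).1.
  have Upi (x : dec) : U (src (dec_arrow x)) -> U (pi (dec_point x)).
    by rewrite dec_arrowP.
  exists (@src R X @^-1` U), psi1, chi1; split.
  + split=> //; apply: open_comp oU => f _; exact: smooth_at_continuous (ssrc f).
  + split=> [x /Upi Ux|f k Uf'].
      have sx := @smooth_at_id R dec x aD.
      have spx : smooth_at (fun x : dec => psi (dec_point x)) x.
        apply: (@smooth_at_comp _ _ _ _ (fun z : dec => dec_point z) psi) => //.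
          exact: smooth_at_dec_point sx.
        exact: spsi.
      apply: (@smooth_at_pair R dec H G) => //.
      apply: smooth_at_cm_act => //; apply: smooth_at_invg => //.
      exact: smooth_at_decoration sx.
    have aXS := prod_atlas aX1 aS.
    pose y0 : ar X * sdprod cm := (f, k).
    have s1 : smooth_at (fun z : ar X * sdprod cm => z.1) y0.
      exact: smooth_at_fst.
    have s2 : smooth_at (fun z : ar X * sdprod cm => z.2) y0.
      exact: smooth_at_snd.
    have sh : smooth_at (fun z : ar X * sdprod cm => z.2.1 : H) y0.
      exact: (@smooth_at_fst_comp R _ aXS H G).
    have sg : smooth_at (fun z : ar X * sdprod cm => z.2.2 : G) y0.
      exact: (@smooth_at_snd_comp R _ aXS H G).
    have ss : smooth_at (fun z : ar X * sdprod cm => src z.1) y0.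
      by apply: (@smooth_at_comp _ _ _ _ (fun z : ar X * sdprod cm => z.1)
        (@src R X)).
    have nU : \forall z \near y0, U (src z.1).
      by apply: (smooth_at_continuous ss); apply: open_nbhs_nbhs.
    apply: smooth_at_into_dec => //.
    * apply: smooth_at_eq s1 => //.
      by apply: filterS nU => z Uz; rewrite /dec_arrow chi1E.
    * apply: (@smooth_at_eq _ _ _
        (fun z : ar X * sdprod cm => chi (src z.1, z.2.2))) => //.
        by apply: filterS nU => z Uz; rewrite /dec_point chi1E.
      apply: (@smooth_at_comp2 R _ (ob X) G E chi
        (fun z : ar X * sdprod cm => src z.1) (fun z => z.2.2)) => //.
      exact: schi.
    * by apply: smooth_at_cm_act => //; apply: smooth_at_invg.
  + move=> x Ux; apply: dec_eq => //=.
    * by rewrite {1}/dec_arrow chi1E.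
    * by rewrite {1}/dec_point chi1E //= dec_arrowP chiK //; exact: Upi.
    * by rewrite -cm_actV invgK cm_actK.
  + move=> f [h g] Uf'; have p1 : dec_point (chi1 (f, (h, g))) = chi (src f, g).
      by rewrite /dec_point chi1E.
    split; first by rewrite /dec_arrow chi1E.
    rewrite /psi1 p1 (pi_chi _ g Uf').2 /= -cm_actV invgK.
    by rewrite cm_actVK.
  + move=> x [h g] Ux.
    rewrite /psi1 /= {1 2}/dec_point /= psi_act; last exact: Upi.
    congr (_, _); rewrite /= -cm_actV -cm_actM mulgK invgM invgK.
    by rewrite cm_act_hom.
Qed.

End DecoratedGroupoid.

Theorem proposition3p11 (R : realType) (G H : preLieGroupType R)
    (cm : crossed_module G H) (hcm : is_lie_crossed_module cm)
    (X : groupoid R) (E : premanifoldType R) (pi : E -> ob X) (act : E * G -> E)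
    (mu : set_type (fibre (@src R X) pi) -> E)
    (hE : is_principal_groupoid_bundle act mu) :
  is_lie_groupoid (dec_groupoid cm hE) /\
  @is_principal_2bundle R (cm_two_group cm) X (dec_groupoid cm hE)
    pi (@dec_arrow R H X E pi) act (@dec_rho R G H cm X E pi act mu hE).
Proof.
have dec_groupoidP := dec_lie_groupoid hE hcm.
split=> //; split=> //.
- exact: cm_lie_2group.
- exact: pgb_groupoid hE.
- exact: dec_projection_functor.
- exact: dec_action_functor.
- exact: pgb_bundle hE.
- exact: dec_arrow_bundle.
Qed.
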